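(* Let $E,F$ be $\mathbb{K}$-Banach spaces, and suppose that one of the following two situations holds: (Context 1) $X$ and $Y$ are bounded complete metric spaces, $A(X,E)=\mathrm{Lip}(X,E)$ and $A(Y,F)=\mathrm{Lip}(Y,F)$; (Context 2) $X$ and $Y$ are compact subsets of the real line, $A(X,E)=AC(X,E)$ and $A(Y,F)=AC(Y,F)$. Let $T:A(X,E)\rightarrow A(Y,F)$ be a bijective linear map preserving common zeros. Then $T$ is continuous if one of the following conditions is satisfied: (1) $E$ and $F$ have the same finite dimension; (2) $Y$ has no isolated points.
   Context: $\mathbb{K}$ is $\mathbb{R}$ or $\mathbb{C}$. $\mathrm{Lip}(X,E)$ is the space of all bounded $E$-valued Lipschitz functions on $X$, endowed with the norm $\|f\|=\max\{\|f\|_\infty, L(f)\}$, where $L(f)$ is the least Lipschitz constant of $f$. For a compact set $X\subset\mathbb{R}$, $AC(X,E)$ is the space of absolutely continuous functions $f:X\to E$: for every $\varepsilon>0$ there is $\delta>0$ such that $\sum_{i=1}^k\|f(b_i)-f(a_i)\|<\varepsilon$ for every finite family of pairwise disjoint open intervals $(a_i,b_i)$ with endpoints $a_i,b_i\in X$ and $\sum_{i=1}^k(b_i-a_i)<\delta$. It is endowed with the norm $\|f\|=\|f\|_\infty+V(f)$, where $V(f)$ is the total variation of $f$ on $X$, i.e. the supremum of $\sum_{i=1}^k\|f(x_i)-f(x_{i-1})\|$ over all finite increasing sequences $x_0<x_1<\dots<x_k$ in $X$. For $f\in A(X,E)$, $Z(f)=\{x\in X: f(x)=0\}$, and similarly on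 $Y$. A linear map $T:A(X,E)\to A(Y,F)$ preserves common zeros if, for all $f,g\in A(X,E)$, $Z(f)\cap Z(g)\neq\emptyset \Longleftrightarrow Z(Tf)\cap Z(Tg)\neq\emptyset$. *)

(* Defs.v *)
From HB Require Import structures.
From mathcomp Require Import all_boot all_order all_algebra.
From mathcomp Require Import all_classical all_reals all_analysis.
From mathcomp.real_closed Require Import complex.
From mathcomp Require Import lra.
Set Implicit Arguments.
Unset Strict Implicit.
Unset Printing Implicit Defensive.
Import Order.TTheory GRing.Theory Num.Theory.
Import numFieldNormedType.Exports.
Local Open Scope classical_set_scope.
Local Open Scope ring_scope.

Variant scalar_kind := RealScalars | ComplexScalars.

Definition scalar_field (R : realType) (k : scalar_kind) : numFieldType :=
  match k with RealScalars => R | ComplexScalars => R[i] end.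

Definition scalar_of_real (R : realType) (k : scalar_kind) :
    R -> scalar_field R k :=
  match k with
  | RealScalars => fun x => x
  | ComplexScalars => fun x => Complex x 0
  end.

Definition real_of_scalar (R : realType) (k : scalar_kind) :
    scalar_field R k -> R :=
  match k with
  | RealScalars => fun x => x
  | ComplexScalars => fun z => complex.Re z
  end.

(* In a normedModType K the norm takes its values in K, hence in R[i] for a
   complex space; normR is the same norm, seen in R. *)
Definition normR (R : realType) (k : scalar_kind)
  (E : normedModType (scalar_field R k)) (x : E) : R := real_of_scalar `|x|.

Section scalar_theory.
Context (R : realType) (k : scalar_kind).
Local Notation K := (scalar_field R k).
Local Notation ofR := (@scalar_of_real R k).
Local Notation toR := (@real_of_scalar R k).

Lemma scalar_of_realK : cancel ofR toR.
Proof. by case: k. Qed.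

Lemma real_of_scalarK (z : K) : 0 <= z -> ofR (toR z) = z.
Proof.
by case: k z => //= -[a b]; rewrite lecE/= => /andP[/eqP -> _].
Qed.

Lemma scalar_of_real_le (x y : R) : (ofR x <= ofR y) = (x <= y).
Proof. by case: k => //=; rewrite lecE/= eqxx. Qed.

Lemma scalar_of_realD (x y : R) : ofR (x + y) = ofR x + ofR y.
Proof. by case: k => //=; apply/eqP; rewrite eq_complex/= addr0 !eqxx. Qed.

Lemma scalar_of_realM (x y : R) : ofR (x * y) = ofR x * ofR y.
Proof.
case: k => //=; apply/eqP.
by rewrite eq_complex/= !mulr0 mul0r subr0 addr0 !eqxx.
Qed.

Lemma scalar_of_real0 : ofR 0 = 0.
Proof. by case: k. Qed.

Lemma scalar_of_real1 : ofR 1 = 1.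
Proof. by case: k. Qed.

Definition absR (a : K) : R := toR `|a|.

Lemma absRK a : ofR (absR a) = `|a|.
Proof. exact: real_of_scalarK. Qed.

Lemma absR_ge0 a : 0 <= absR a.
Proof. by rewrite -scalar_of_real_le scalar_of_real0 absRK. Qed.

Lemma absR0 : absR 0 = 0.
Proof. by rewrite /absR normr0 -scalar_of_real0 scalar_of_realK. Qed.

Lemma absRM a b : absR (a * b) = absR a * absR b.
Proof.
by rewrite -[RHS]scalar_of_realK scalar_of_realM !absRK -normrM.
Qed.

Lemma absR1 : absR 1 = 1.
Proof. by rewrite /absR normr1 -scalar_of_real1 scalar_of_realK. Qed.

Section norm.
Context (E : normedModType K).

Lemma normRK (x : E) : ofR (normR x) = `|x|.
Proof. exact: real_of_scalarK. Qed.

Lemma normR_ge0 (x : E) : 0 <= normR x.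
Proof. by rewrite -scalar_of_real_le scalar_of_real0 normRK. Qed.

Lemma normR0 : normR (0 : E) = 0.
Proof. by rewrite /normR normr0 -scalar_of_real0 scalar_of_realK. Qed.

Lemma normR0_eq0 (x : E) : normR x = 0 -> x = 0.
Proof.
by move=> x0; apply/normr0_eq0; rewrite -normRK x0 scalar_of_real0.
Qed.

Lemma ler_normRD (x y : E) : normR (x + y) <= normR x + normR y.
Proof.
by rewrite -scalar_of_real_le scalar_of_realD !normRK ler_normD.
Qed.

Lemma normRZ a (x : E) : normR (a *: x) = absR a * normR x.
Proof.
rewrite -[RHS]scalar_of_realK scalar_of_realM absRK normRK -normrZ.
by [].
Qed.

Lemma normRN (x : E) : normR (- x) = normR x.
Proof. by rewrite /normR normrN. Qed.

Lemma ler_normRB (x y : E) : normR (x - y) <= normR x + normR y.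
Proof. by rewrite (le_trans (ler_normRD _ _))// normRN. Qed.

End norm.

Lemma seminormZ (V : lmodType K) (N : V -> R) :
  (forall v, 0 <= N v) -> (forall a v, N (a *: v) <= absR a * N v) ->
  forall a v, N (a *: v) = absR a * N v.
Proof.
move=> N0 NZ a v; apply/eqP; rewrite eq_le NZ/=.
have [->|a0] := eqVneq a 0; first by rewrite absR0 mul0r N0.
have Na0 : 0 < absR a.
  rewrite lt_neqAle absR_ge0 andbT eq_sym; apply/eqP => h.
  by move: (absRK a); rewrite h scalar_of_real0 => /esym/normr0_eq0/eqP; apply/negP.
have := NZ a^-1 (a *: v); rewrite scalerA mulVf// scale1r => h.
have e : absR a * absR a^-1 = 1 by rewrite -absRM mulfV// absR1.
by rewrite (le_trans (ler_wpM2l (ltW Na0) h))// mulrA e mul1r.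
Qed.

End scalar_theory.

Section supnorm.
Context (R : realType) (k : scalar_kind) (X : Type)
  (E : normedModType (scalar_field R k)).

Definition bounded_map (f : X -> E) := exists M : R, forall x, normR (f x) <= M.

(* This is 0 when X is empty, since sup set0 = 0. *)
Definition supnorm (f : X -> E) : R := sup (range (fun x => normR (f x))).

Lemma supnorm_ub f : bounded_map f -> forall x, normR (f x) <= supnorm f.
Proof.
move=> [M fM] x; apply: ub_le_sup; last by exists x.
by exists M => _ [y _ <-].
Qed.

Lemma supnorm_le f (M : R) :
  0 <= M -> (forall x, normR (f x) <= M) -> supnorm f <= M.
Proof.
move=> M0 fM; rewrite /supnorm.
have [->|/set0P ne] := eqVneq (range (fun x => normR (f x))) set0.
  by rewrite sup0.
by apply: ge_sup => // _ [y _ <-].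
Qed.

Lemma supnorm_ge0 f : 0 <= supnorm f.
Proof.
rewrite /supnorm.
have [->|/set0P ne] := eqVneq (range (fun x => normR (f x))) set0.
  by rewrite sup0.
case: (pselect (has_sup (range (fun x => normR (f x))))) => [h|h].
  case: ne => _ [x _ _]; apply: (le_trans (normR_ge0 (f x))).
  by apply: ub_le_sup; [case: h|exists x].
by rewrite sup_out.
Qed.

Lemma supnormD f g : bounded_map f -> bounded_map g ->
  supnorm (f + g) <= supnorm f + supnorm g.
Proof.
move=> bf bg; apply: supnorm_le; first by rewrite addr_ge0 ?supnorm_ge0.
move=> x; rewrite (le_trans (ler_normRD _ _))// lerD ?supnorm_ub//.
Qed.

Lemma supnormZ a f : bounded_map f -> supnorm (a *: f) <= absR a * supnorm f.
Proof.
move=> bf; apply: supnorm_le; first by rewrite mulr_ge0 ?absR_ge0 ?supnorm_ge0.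
by move=> x; rewrite normRZ ler_wpM2l ?absR_ge0 ?supnorm_ub.
Qed.

Lemma supnorm0_eq0 f : bounded_map f -> supnorm f = 0 -> f = 0.
Proof.
move=> bf f0; apply/funext => x; apply: normR0_eq0; apply/eqP.
by rewrite eq_le normR_ge0 andbT -f0 supnorm_ub.
Qed.

Lemma bounded_map0 : bounded_map 0.
Proof. by exists 0 => x; rewrite normR0. Qed.

Lemma bounded_mapD f g : bounded_map f -> bounded_map g -> bounded_map (f + g).
Proof.
move=> [M fM] [N gN]; exists (M + N) => x.
by rewrite (le_trans (ler_normRD _ _))// lerD.
Qed.

Lemma bounded_mapZ a f : bounded_map f -> bounded_map (a *: f).
Proof.
move=> [M fM]; exists (absR a * M) => x.
by rewrite normRZ ler_wpM2l ?absR_ge0.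
Qed.

End supnorm.

Section lipschitz.
Context (R : realType) (k : scalar_kind) (X : metricType R)
  (E : normedModType (scalar_field R k)).

Definition lip_bound (f : X -> E) (L : R) :=
  0 <= L /\ forall x y, normR (f x - f y) <= L * mdist x y.

Definition lip_const (f : X -> E) : R := inf [set L | lip_bound f L].

Definition is_lip (f : X -> E) := bounded_map f /\ exists L, lip_bound f L.

Definition lip_pred : {pred (X -> E)} := fun f => `[< is_lip f >].

Lemma lip_const_ge0 f : 0 <= lip_const f.
Proof.
rewrite /lip_const; have [->|/set0P ne] := eqVneq [set L | lip_bound f L] set0.
  by rewrite inf0.
by apply: lb_le_inf => // L [].
Qed.

Lemma lip_const_le f L : lip_bound f L -> lip_const f <= L.
Proof. by move=> fL; apply: ge_inf => //; exists 0 => M []. Qed.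

Lemma lip_constP f : is_lip f -> lip_bound f (lip_const f).
Proof.
move=> [_ [L fL]]; split=> [|x y]; first exact: lip_const_ge0.
have [<-|xy] := eqVneq x y.
  by rewrite subrr normR0 mdistxx mulr0.
have d0 : 0 < mdist x y by rewrite mdist_gt0.
rewrite -ler_pdivrMr//; apply: lb_le_inf; first by exists L.
by move=> M [_ fM]; rewrite ler_pdivrMr.
Qed.

Lemma lip_bound0 : lip_bound 0 0.
Proof. by split=> // x y; rewrite subrr normR0 mul0r. Qed.

Lemma lip_boundD f g L M :
  lip_bound f L -> lip_bound g M -> lip_bound (f + g) (L + M).
Proof.
move=> [L0 fL] [M0 gM]; split=> [|x y]; first exact: addr_ge0.
have -> : (f + g) x - (f + g) y = (f x - f y) + (g x - g y).
  by rewrite addrACA -opprD.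
by rewrite (le_trans (ler_normRD _ _))// mulrDl lerD.
Qed.

Lemma lip_boundZ a f L : lip_bound f L -> lip_bound (a *: f) (absR a * L).
Proof.
move=> [L0 fL]; split=> [|x y]; first by rewrite mulr_ge0 ?absR_ge0.
have -> : (a *: f) x - (a *: f) y = a *: (f x - f y) by rewrite scalerBr.
by rewrite normRZ -mulrA ler_wpM2l ?absR_ge0.
Qed.

Lemma lip_submod_closed : submod_closed lip_pred.
Proof.
split.
  apply/asboolP; split; first exact: bounded_map0.
  by exists 0; exact: lip_bound0.
move=> a f g /asboolP[bf [L fL]] /asboolP[bg [M gM]]; apply/asboolP; split.
  exact: bounded_mapD (bounded_mapZ a bf) bg.
by exists (absR a * L + M); apply: lip_boundD gM; exact: lip_boundZ.
Qed.

HB.instance Definition _ :=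
  GRing.isSubmodClosed.Build (scalar_field R k) (X -> E) lip_pred lip_submod_closed.

Record lip := Lip { lip_fun :> X -> E ; _ : lip_pred lip_fun }.

HB.instance Definition _ := [isSub for lip_fun].
HB.instance Definition _ := [Choice of lip by <:].
HB.instance Definition _ := [SubChoice_isSubLmodule of lip by <:].

Definition lip_norm (f : lip) : R := Num.max (supnorm f) (lip_const f).

Lemma lipP (f : lip) : is_lip f.
Proof. exact/asboolP/(valP f). Qed.

Lemma lip_norm_ge0 f : 0 <= lip_norm f.
Proof. by rewrite le_max supnorm_ge0. Qed.

Lemma ler_lip_normD f g : lip_norm (f + g) <= lip_norm f + lip_norm g.
Proof.
have [bf _] := lipP f; have [bg _] := lipP g.
rewrite ge_max; apply/andP; split.
  apply: (le_trans (supnormD bf bg)).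
  by apply: lerD; rewrite le_max lexx.
apply: (@le_trans _ _ (lip_const f + lip_const g)).
  by apply: lip_const_le; apply: lip_boundD; exact/lip_constP/lipP.
by apply: lerD; rewrite le_max lexx orbT.
Qed.

Lemma lip_normZ a f : lip_norm (a *: f) = absR a * lip_norm f.
Proof.
apply: (seminormZ lip_norm_ge0) => {}a {}f; have [bf _] := lipP f.
rewrite ge_max; apply/andP; split.
  by rewrite (le_trans (supnormZ a bf))// ler_wpM2l ?absR_ge0// le_max lexx.
apply: (@le_trans _ _ (absR a * lip_const f)).
  by apply: lip_const_le; apply: lip_boundZ; exact/lip_constP/lipP.
by rewrite ler_wpM2l ?absR_ge0// le_max lexx orbT.
Qed.

Lemma lip_norm0_eq0 f : lip_norm f = 0 -> f = 0.
Proof.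
move=> f0; have [bf _] := lipP f; apply/val_inj/(supnorm0_eq0 bf)/eqP.
by rewrite eq_le supnorm_ge0 andbT -f0 le_max lexx.
Qed.

Local Notation ofR := (@scalar_of_real R k).

Let ler_normD (f g : lip) :
  ofR (lip_norm (f + g)) <= ofR (lip_norm f) + ofR (lip_norm g).
Proof. by rewrite -scalar_of_realD scalar_of_real_le ler_lip_normD. Qed.

Let normrZ (a : scalar_field R k) (f : lip) :
  ofR (lip_norm (a *: f)) = `|a| * ofR (lip_norm f).
Proof. by rewrite lip_normZ scalar_of_realM absRK. Qed.

Let normr0_eq0 (f : lip) : ofR (lip_norm f) = 0 -> f = 0.
Proof.
rewrite -(scalar_of_real0 R k) => /(can_inj (@scalar_of_realK R k)).
exact: lip_norm0_eq0.
Qed.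

HB.instance Definition _ :=
  Lmodule_isNormed.Build (scalar_field R k) lip ler_normD normrZ normr0_eq0.

End lipschitz.

Record compact_set (R : realType) :=
  CompactSet { compact_set_set :> set R ; _ : compact compact_set_set }.

Section absolutely_continuous.
Context (R : realType) (k : scalar_kind) (X : compact_set R)
  (E : normedModType (scalar_field R k)).

Definition is_ac (f : X -> E) :=
  forall eps : R, 0 < eps -> exists2 d : R, 0 < d &
    forall (n : nat) (a b : 'I_n -> X),
      (forall i, val (a i) < val (b i)) ->
      trivIset setT (fun i => `]val (a i), val (b i)[%classic) ->
      \sum_(i < n) (val (b i) - val (a i)) < d ->
      \sum_(i < n) normR (f (b i) - f (a i)) < eps.

(* Only x 0, ..., x n matter. *)
Definition increasing_chain (n : nat) (x : nat -> X) :=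
  forall i, (i < n)%N -> val (x i) < val (x i.+1).

Definition total_var (f : X -> E) : R :=
  sup [set v | exists (n : nat) (x : nat -> X), increasing_chain n x /\
                 v = \sum_(i < n) normR (f (x i.+1) - f (x i))].

Definition ac_pred : {pred (X -> E)} := fun f => `[< is_ac f >].

Lemma ac_submod_closed : submod_closed ac_pred.
Proof.
split.
  apply/asboolP => eps e0; exists 1 => // n a b _ _ _.
  by rewrite big1// => i _; rewrite subrr normR0.
move=> c f g /asboolP acf /asboolP acg; apply/asboolP => eps e0.
have c1 : 0 < absR c + 1 by rewrite ltr_wpDl// absR_ge0.
have [d1 d10 hf] := acf (eps / 2 / (absR c + 1)) (divr_gt0 (divr_gt0 e0 (ltr0Sn _ 1)) c1).
have [d2 d20 hg] := acg (eps / 2) (divr_gt0 e0 (ltr0Sn _ 1)).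
exists (Num.min d1 d2); first by rewrite lt_min d10.
move=> n a b ab tI; rewrite lt_min => /andP[/(hf _ _ _ ab tI) {}hf].
move=> /(hg _ _ _ ab tI) {}hg.
apply: (@le_lt_trans _ _ (absR c * \sum_(i < n) normR (f (b i) - f (a i)) +
    \sum_(i < n) normR (g (b i) - g (a i)))).
  rewrite mulr_sumr -big_split/=; apply: ler_sum => i _.
  have -> : (c *: f + g) (b i) - (c *: f + g) (a i) =
      c *: (f (b i) - f (a i)) + (g (b i) - g (a i)).
    by rewrite scalerBr addrACA -opprD.
  by rewrite (le_trans (ler_normRD _ _))// normRZ.
rewrite [ltRHS](splitr eps) ler_ltD// ltW//.
move: hf; rewrite ltr_pdivlMr//; apply: le_lt_trans.
rewrite mulrDr mulr1 mulrC lerDl.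
by apply: sumr_ge0 => i _; exact: normR_ge0.
Qed.

HB.instance Definition _ :=
  GRing.isSubmodClosed.Build (scalar_field R k) (X -> E) ac_pred ac_submod_closed.

Record ac := Ac { ac_fun :> X -> E ; _ : ac_pred ac_fun }.

HB.instance Definition _ := [isSub for ac_fun].
HB.instance Definition _ := [Choice of ac by <:].
HB.instance Definition _ := [SubChoice_isSubLmodule of ac by <:].

Lemma acP (f : ac) : is_ac f.
Proof. exact/asboolP/(valP f). Qed.

Let varseg (f : X -> E) (x : nat -> X) p q : R :=
  \sum_(p <= i < q) normR (f (x i.+1) - f (x i)).

Let inc (x : nat -> X) p q :=
  forall i, (p <= i < q)%N -> val (x i) < val (x i.+1).

Let inc_le x p q i j : inc x p q -> (p <= i)%N -> (i <= j)%N -> (j <= q)%N ->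
  val (x i) <= val (x j).
Proof.
move=> ix pi; elim: j => [|j IH]; first by rewrite leqn0 => /eqP ->.
rewrite leq_eqVlt => /orP[/eqP -> //|]; rewrite ltnS => ij jq.
by rewrite (le_trans (IH ij (ltnW jq)))// ltW// ix// jq (leq_trans pi).
Qed.

Let small_var f : is_ac f -> exists2 d : R, 0 < d &
  forall x p q, (p <= q)%N -> inc x p q -> val (x q) - val (x p) < d ->
    varseg f x p q <= 1.
Proof.
move=> acf; have [d d0 fd] := acf 1 ltr01; exists d => // x p q pq ix xd.
rewrite /varseg -{1}[p]add0n big_addn big_mkord; apply/ltW.
apply: (fd _ (fun i : 'I_(q - p) => x (i + p)%N) (fun i => x (i + p).+1)).
- by move=> i; apply: ix; rewrite leq_addl/= addnC -ltn_subRL.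
- apply/trivIsetP => i j _ _ ij; wlog : i j ij / (i < j)%N => [hw|ltij].
    case: (ltngtP i j) => [||/val_inj e]; first exact: hw.
      by rewrite setIC; apply: hw; rewrite eq_sym.
    by rewrite e eqxx in ij.
  rewrite -subset0 => z [/=].
  rewrite !in_itv/= => /andP[_ zi] /andP[jz _].
  have : val (x (i + p).+1) <= val (x (j + p)%N).
    apply: (inc_le ix).
    + by rewrite leqW// leq_addl.
    + by rewrite -addSn leq_add2r.
    + by rewrite ltnW// addnC -ltn_subRL.
  by rewrite leNgt (lt_trans jz zi).
- rewrite -(big_mkord xpredT (fun i => val (x (i + p).+1) - val (x (i + p)%N))).
  rewrite (@telescope_sumr _ _ _ (fun i => val (x (i + p)%N)))//.
  by rewrite add0n subnK.
Qed.

Let close_bound f : is_ac f -> exists2 d : R, 0 < d &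
  forall x y : X, val x - val y < d -> val y - val x < d ->
    normR (f x - f y) <= 1.
Proof.
move=> /small_var[d d0 fd]; exists d => // x y.
wlog : x y / val y < val x => [hw|yx xy _].
  case: (ltgtP (val y) (val x)) => [||/val_inj -> _ _]; first exact: hw.
  - by move=> /hw h1 h2 h3; rewrite -normRN opprB h1.
  - by rewrite subrr normR0 ler01.
have := fd (fun i => if i is 0%N then y else x) 0%N 1%N.
rewrite /varseg big_nat1/=; apply => //.
by move=> -[|i]//.
Qed.

Let range_bound : exists M : R, forall x : X, - M < val x <= M.
Proof.
have : bounded_set (X : set R^o) by apply: compact_bounded; case: X.
move=> [M [Mr hM]]; exists (`|M| + 1) => x.
have /ltr_normlP[h1 h2] : `|val x| < `|M| + 1.
  apply: (@le_lt_trans _ _ (`|M| + 1 / 2)); last by rewrite ltrD2l; lra.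
  apply: hM; last exact/set_mem/(valP x).
  by rewrite (le_lt_trans (ler_norm M))// ltrDl.
by rewrite ltrNl h1 ltW.
Qed.

Let range_cells (d : R) : 0 < d -> exists (M : R) (N : nat),
  forall x : X, - M < val x <= - M + N%:R * d.
Proof.
move=> d0; have [M hM] := range_bound.
exists M, (Num.bound (2 * `|M| / d)) => x; have /andP[-> xM]/= := hM x.
have h0 : 0 <= 2 * `|M| / d by rewrite divr_ge0 ?mulr_ge0 ?normr_ge0 ?ler0n ?(ltW d0).
have := archi_boundP h0.
rewrite ltr_pdivrMr// => /ltW h; rewrite addrC lerBrDr (le_trans _ h)//.
by rewrite mulr_natl mulr2n lerD ?ler_norm ?(le_trans xM)// ler_norm.
Qed.

Lemma is_ac_bounded f : is_ac f -> bounded_map f.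
Proof.
move=> /close_bound[d d0 fd]; have [c [N hN]] := range_cells (divr_gt0 d0 (ltr0Sn _ 1)).
suff H m : exists M : R, forall x : X, val x <= - c + m%:R * (d / 2) ->
    normR (f x) <= M.
  by have [M hM] := H N; exists M => x; apply: hM; have /andP[] := hN x.
elim: m => [|m [M IH]].
  exists 0 => x; rewrite mul0r addr0 leNgt; have /andP[-> _] := hN x.
  by [].
case: (pselect (exists p : X, - c + m%:R * (d / 2) < val p <= - c + m.+1%:R * (d / 2))).
  move=> [p /andP[p1 p2]]; exists (Num.max M (normR (f p) + 1)) => x x2.
  rewrite le_max; case: (leP (val x) (- c + m%:R * (d / 2))) => [/IH->//|x1].
  apply/orP; right; rewrite -(subrK (f p) (f x)) addrC.
  rewrite (le_trans (ler_normRD _ _))// lerD2l fd//;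
  by move: p2 x2; rewrite -natr1 mulrDl mul1r; lra.
move=> np; exists M => x x2; apply: IH; rewrite leNgt; apply/negP => x1.
by apply: np; exists x; rewrite x1.
Qed.

Lemma is_ac_var f : is_ac f -> exists B : R, forall n x,
  increasing_chain n x -> \sum_(i < n) normR (f (x i.+1) - f (x i)) <= B.
Proof.
move=> acf; have [M fM] := is_ac_bounded acf.
have [d d0 fd] := small_var acf.
have [c [N hN]] := range_cells (divr_gt0 d0 (ltr0Sn _ 1)).
suff H m : exists B : R, forall x p q, (p <= q)%N -> inc x p q ->
    val (x q) <= - c + m%:R * (d / 2) -> varseg f x p q <= B.
  have [B hB] := H N; exists B => n x ix.
  rewrite -(big_mkord xpredT (fun i => normR (f (x i.+1) - f (x i)))).
  by apply: hB => //; have /andP[] := hN (x n).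
elim: m => [|m [B IH]].
  exists 0 => x p q _ _; rewrite mul0r addr0 leNgt; have /andP[-> _] := hN (x q).
  by [].
exists (`|B| + (`|M| + `|M|) + 1) => x p q pq ix xq.
set t := - c + m%:R * (d / 2).
have B0 := ler_norm B; have M0 := ler_norm M.
have nB := normr_ge0 B; have nM := normr_ge0 M.
have tE : - c + m.+1%:R * (d / 2) = t + d / 2.
  by rewrite /t -natr1 mulrDl mul1r addrA.
case: (leP (val (x q)) t) => [xqt|txq].
  by have := IH _ _ _ pq ix xqt; lra.
case: (leP (val (x p)) t) => [xpt|txp]; last first.
  suff : varseg f x p q <= 1 by lra.
  by apply: fd => //; move: xq; rewrite tE; lra.
have [j /andP[pj jq] [xj xj1]] : exists2 j, (p <= j < q)%N &
    val (x j) <= t /\ t < val (x j.+1).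
  have [j jP jmin] := ex_minnP (ex_intro (fun j => (p <= j)%N && (t < val (x j))) q
    (introT andP (conj pq txq))).
  case/andP: jP => pj tj.
  have ltpj : (p < j)%N.
    rewrite ltn_neqAle pj andbT; apply/eqP => e.
    by move: tj; rewrite -e ltNge xpt.
  have jq : (j <= q)%N by apply: jmin; rewrite pq.
  exists j.-1; first by rewrite -ltnS prednK ?(leq_trans _ ltpj)// ltpj.
  rewrite prednK ?(leq_trans _ ltpj)//; split=> //.
  rewrite leNgt; apply/negP => tj1.
  have : (j <= j.-1)%N by apply: jmin; rewrite tj1 -ltnS prednK ?ltpj// (leq_trans _ ltpj).
  by rewrite -ltnS prednK ?ltnn// (leq_trans _ ltpj).
rewrite /varseg (big_cat_nat pj (ltnW jq))/= (big_ltn jq) addrA.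
apply: lerD; first apply: lerD.
- apply: le_trans B0; apply: IH => // i /andP[pi ij].
  by apply: ix; rewrite pi (ltn_trans ij).
- rewrite (le_trans (ler_normRB _ _))// lerD// (le_trans (fM _))//.
- apply: fd => //.
    by move=> i /andP[pi iq]; apply: ix; rewrite iq andbT (leq_trans _ pi)// leqW.
  by move: xq; rewrite tE; lra.
Qed.

Lemma total_var_ub f : is_ac f -> forall n x, increasing_chain n x ->
  \sum_(i < n) normR (f (x i.+1) - f (x i)) <= total_var f.
Proof.
move=> /is_ac_var[B fB] n x ix; apply: ub_le_sup; last by exists n, x.
by exists B => _ [m [y [iy ->]]]; exact: fB.
Qed.

Lemma total_var_le f (B : R) : 0 <= B -> (forall n x, increasing_chain n x ->
  \sum_(i < n) normR (f (x i.+1) - f (x i)) <= B) -> total_var f <= B.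
Proof.
move=> B0 fB; rewrite /total_var; set S := [set _ | _].
have [->|/set0P ne] := eqVneq S set0; first by rewrite sup0.
by apply: ge_sup => // _ [m [y [iy ->]]]; exact: fB.
Qed.

Lemma total_var_ge0 f : 0 <= total_var f.
Proof.
rewrite /total_var; set S := [set _ | _].
case: (pselect (has_sup S)) => [h|h]; last by rewrite sup_out.
case: (h) => -[_ [n [x [ix _]]]] hub.
by apply: ub_le_sup => //; exists 0%N, x; rewrite big_ord0.
Qed.

Definition ac_norm (f : ac) : R := supnorm f + total_var f.

Lemma ac_norm_ge0 f : 0 <= ac_norm f.
Proof. by rewrite addr_ge0 ?supnorm_ge0 ?total_var_ge0. Qed.

Lemma ler_ac_normD f g : ac_norm (f + g) <= ac_norm f + ac_norm g.
Proof.
have bf := is_ac_bounded (acP f); have bg := is_ac_bounded (acP g).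
rewrite /ac_norm addrACA; apply: lerD; first exact: supnormD.
apply: total_var_le; first by rewrite addr_ge0 ?total_var_ge0.
move=> n x ix; apply: le_trans (lerD (total_var_ub (acP f) ix)
  (total_var_ub (acP g) ix)).
rewrite -big_split/=; apply: ler_sum => i _.
apply: le_trans (ler_normRD _ _); rewrite addrACA -opprD.
by [].
Qed.

Lemma ac_normZ a f : ac_norm (a *: f) = absR a * ac_norm f.
Proof.
apply: (seminormZ ac_norm_ge0) => {}a {}f.
rewrite /ac_norm mulrDr; apply: lerD.
  exact/supnormZ/is_ac_bounded/acP.
apply: total_var_le; first by rewrite mulr_ge0 ?absR_ge0 ?total_var_ge0.
move=> n x ix; have := ler_wpM2l (absR_ge0 a) (total_var_ub (acP f) ix).
apply: le_trans; rewrite mulr_sumr; apply: ler_sum => i _.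
by rewrite -normRZ scalerBr.
Qed.

Lemma ac_norm0_eq0 f : ac_norm f = 0 -> f = 0.
Proof.
move=> f0; apply/val_inj/(supnorm0_eq0 (is_ac_bounded (acP f)))/eqP.
by rewrite eq_le supnorm_ge0 andbT -f0 lerDl total_var_ge0.
Qed.

Local Notation ofR := (@scalar_of_real R k).

Let ler_normD (f g : ac) :
  ofR (ac_norm (f + g)) <= ofR (ac_norm f) + ofR (ac_norm g).
Proof. by rewrite -scalar_of_realD scalar_of_real_le ler_ac_normD. Qed.

Let normrZ (a : scalar_field R k) (f : ac) :
  ofR (ac_norm (a *: f)) = `|a| * ofR (ac_norm f).
Proof. by rewrite ac_normZ scalar_of_realM absRK. Qed.

Let normr0_eq0 (f : ac) : ofR (ac_norm f) = 0 -> f = 0.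
Proof.
rewrite -(scalar_of_real0 R k) => /(can_inj (@scalar_of_realK R k)).
exact: ac_norm0_eq0.
Qed.

HB.instance Definition _ :=
  Lmodule_isNormed.Build (scalar_field R k) ac ler_normD normrZ normr0_eq0.

End absolutely_continuous.

Definition bounded_space (R : realType) (X : metricType R) :=
  exists M : R, forall x y : X, mdist x y <= M.

(* The library's completeType requires a point; X may be empty here. *)
Definition complete_space (X : uniformType) :=
  forall F : set_system X, ProperFilter F -> cauchy F -> exists x : X, F --> x.

Definition zeros (X : Type) (E : nmodType) (f : X -> E) : set X :=
  [set x | f x = 0].

Definition preserves_common_zeros (X Y : Type) (E F : nmodType)
    (P : {pred (X -> E)}) (Q : {pred (Y -> F)}) (A : subType P) (B : subType Q)
    (T : A -> B) :=
  forall f g : A, zeros (val f) `&` zeros (val g) !=set0 <->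
                  zeros (val (T f)) `&` zeros (val (T g)) !=set0.

Definition has_dim (K : fieldType) (V : lmodType K) (n : nat) :=
  exists e : 'I_n -> V,
    (forall c : 'I_n -> K, \sum_(i < n) c i *: e i = 0 -> forall i, c i = 0) /\
    (forall v : V, exists c : 'I_n -> K, v = \sum_(i < n) c i *: e i).

Definition same_finite_dim (K : fieldType) (V W : lmodType K) :=
  exists n : nat, has_dim V n /\ has_dim W n.

(* Main.v *)
(* If [x] is a point and [e <> 0], the function [D(x, .) e] vanishes exactly at
   [x]. Comparing zero sets of such peak functions shows that a bijection
   preserving common zeros satisfies [T f y = 0 <-> f (h y) = 0] for an injective
   map [h : Y -> X]; hence [T f y] depends linearly on [f (h y)] alone.

   If this dependence is bounded for every [y], the evaluations of [T f] are
   bounded in [f], and uniform boundedness for the lower semicontinuous seminorm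
   [f |-> |T f|] gives continuity. Boundedness is automatic when [E] is finite
   dimensional. In general a gliding hump argument leaves only finitely many
   exceptional [y]; uniform boundedness applied to the other points, which are
   dense when [Y] has no isolated point, then bounds all evaluations. *)

Require Import Defs.
From mathcomp Require Import all_boot all_order all_algebra.
From mathcomp Require Import all_classical all_reals all_analysis.
From mathcomp.real_closed Require Import complex.
From mathcomp Require Import ring lra.
Import Order.TTheory GRing.Theory Num.Theory.
Import numFieldNormedType.Exports.
Set Implicit Arguments.
Unset Strict Implicit.
Unset Printing Implicit Defensive.
Local Open Scope classical_set_scope.
Local Open Scope ring_scope.

(** * Normed spaces over the real or complex scalars *)

Lemma halving_small (R : realType) (r : nat -> R) :
  (forall n, r n.+1 <= r n / 2) ->
  forall e, 0 < e -> exists n, forall m, (n <= m)%N -> r m < e.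
Proof.
move=> rS e e0.
have r0 n : r n <= `|r 0%N| * 2^-1 ^+ n.
  elim: n => [|n IH]; first by rewrite expr0 mulr1 ler_norm.
  by rewrite (le_trans (rS n))// exprSr mulrA ler_pM2r// invr_gt0.
have [n hn] : exists n : nat, `|r 0%N| * 2^-1 ^+ n < e.
  exists (Num.bound (`|r 0%N| / e)).
  have h0 : 0 <= `|r 0%N| / e by rewrite divr_ge0// ltW.
  have := archi_boundP h0; set b := Num.bound _ => h.
  rewrite exprVn ltr_pdivrMr ?exprn_gt0//.
  rewrite ltr_pdivrMr// in h; rewrite (lt_le_trans h)// mulrC ler_pM2l//.
  by rewrite -natrX ler_nat ltnW// ltn_expl.
exists n => m nm; apply: le_lt_trans hn; apply: (le_trans (r0 m)).
by rewrite ler_wpM2l// ler_wiXn2l// ?invr_ge0// invf_le1// ler1n.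
Qed.

Section normed_spaces.
Context (R : realType) (k : scalar_kind).
Local Notation K := (scalar_field R k).
Implicit Types V W : normedModType K.

Lemma scalar_of_real_lt (x y : R) :
  (scalar_of_real k x < scalar_of_real k y) = (x < y).
Proof.
rewrite !lt_neqAle scalar_of_real_le.
by rewrite (inj_eq (can_inj (@scalar_of_realK R k))).
Qed.

Lemma real_of_scalar_gt0 (e : K) : 0 < e -> 0 < real_of_scalar e.
Proof.
move=> e0; rewrite -scalar_of_real_lt real_of_scalarK ?ltW//.
by rewrite scalar_of_real0.
Qed.

Lemma normR_distC V (x y : V) : normR (x - y) = normR (y - x).
Proof. by rewrite -normRN opprB. Qed.

Lemma normR_dist_triangle V (y x z : V) :
  normR (x - z) <= normR (x - y) + normR (y - z).
Proof. by rewrite -(subrKA y) ler_normRD. Qed.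

Lemma normR_sum V n (f : 'I_n -> V) :
  normR (\sum_(i < n) f i) <= \sum_(i < n) normR (f i).
Proof.
elim/big_ind2 : _ => //; first by rewrite normR0.
by move=> a b c d ab cd; rewrite (le_trans (ler_normRD _ _))// lerD.
Qed.

Lemma normR_gt0 V (x : V) : x != 0 -> 0 < normR x.
Proof.
move=> x0; rewrite lt_neqAle normR_ge0 andbT eq_sym.
by apply: contra x0 => /eqP/normR0_eq0 ->.
Qed.

Lemma absR_scalar_of_real (x : R) : 0 <= x -> absR (scalar_of_real k x) = x.
Proof.
move=> x0; rewrite /absR ger0_norm ?scalar_of_realK//.
by rewrite -scalar_of_real0 scalar_of_real_le.
Qed.

(** Rates that at least halve have tails summing to at most [2 * r n], so completeness can be stated
    with an explicit error in the real-valued norm. *)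
Definition fast_cauchy V (s : nat -> V) (r : nat -> R) :=
  [/\ forall n, 0 < r n, forall n, r n.+1 <= r n / 2 &
      forall n, normR (s n.+1 - s n) <= r n].

Definition fast_complete V :=
  forall s r, fast_cauchy s r -> exists v : V, forall n, normR (v - s n) <= 2 * r n.

Lemma fast_cauchy_tail V (s : nat -> V) r : fast_cauchy s r ->
  forall n m, (n <= m)%N -> normR (s m - s n) <= 2 * r n.
Proof.
move=> [r0 rS sS] n m /subnK <-.
(* This form is inductive because [r m <= 2 * (r m - r m.+1)]. *)
suff H j : normR (s (j + n)%N - s n) <= 2 * (r n - r (j + n)%N).
  by rewrite (le_trans (H _))// ler_pM2l// gerBl ltW.
elim: j => [|j IH]; first by rewrite !subrr mulr0 normR0.
rewrite addSn (le_trans (normR_dist_triangle (s (j + n)%N) _ _))//.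
by have := sS (j + n)%N; have := rS (j + n)%N; lra.
Qed.

Lemma fast_cauchy_lim V (s : nat -> V) r v : fast_cauchy s r ->
  (forall e, 0 < e -> exists n, forall m, (n <= m)%N -> normR (v - s m) <= e) ->
  forall n, normR (v - s n) <= 2 * r n.
Proof.
move=> gs sv n; apply/ler_addgt0Pr => e /sv[m hm].
rewrite (le_trans (normR_dist_triangle (s (maxn m n)) _ _))// addrC lerD//.
  by apply: fast_cauchy_tail; rewrite ?leq_maxr.
by apply: hm; rewrite leq_maxl.
Qed.

Lemma complete_fast_complete (V : completeNormedModType K) :
  fast_complete V.
Proof.
move=> s r gs; have [_ rS _] := gs.
have cs : cvg (s @ \oo).
  apply/cauchy_cvgP/cauchy_exP => e epos; have e0 := real_of_scalar_gt0 epos.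
  have [n hn] := halving_small rS (divr_gt0 e0 (ltr0Sn _ 1)).
  exists (s n); exists n => // m /= nm.
  rewrite -ball_normE/= -(real_of_scalarK (ltW epos)) -normRK scalar_of_real_lt normR_distC.
  rewrite (le_lt_trans (fast_cauchy_tail gs nm))//.
  by have := hn _ (leqnn n); lra.
exists (lim (s @ \oo)); apply: (fast_cauchy_lim gs) => e e0.
have e0' : 0 < scalar_of_real k e by rewrite -(scalar_of_real0 R k) scalar_of_real_lt.
move/cvgrPdist_le : cs => /(_ _ e0')[n _ hn]; exists n => m nm.
by rewrite -(scalar_of_real_le k) normRK; exact: hn.
Qed.

(** By induction the coordinates on the span of the first [n] vectors are bounded, which makes that
    span complete. The last vector is therefore at positive distance [d] from it, and this bounds
    the last coordinate, then the others. *)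
Lemma free_coord_bound V n (e : 'I_n -> V) : fast_complete K^o ->
  (forall c : 'I_n -> K, \sum_(i < n) c i *: e i = 0 -> forall i, c i = 0) ->
  exists2 C : R, 0 <= C &
    forall (c : 'I_n -> K) i, absR (c i) <= C * normR (\sum_(i < n) c i *: e i).
Proof.
move=> compK; elim: n e => [|n IH] e free_e; first by exists 0 => // c [].
pose e' i := e (widen_ord (leqnSn n) i); pose u := e ord_max.
pose L (c : 'I_n -> K) := \sum_(i < n) c i *: e' i.
have LB c c' : L (fun i => c i - c' i) = L c - L c'.
  by rewrite -sumrB; apply: eq_bigr => i _; rewrite scalerBl.
have free_e' c : L c = 0 -> forall i, c i = 0.
  move=> Lc i.
  have := free_e (fun j => if unlift ord_max j is Some j' then c j' else 0).
  rewrite big_ord_recr/= unlift_none scale0r addr0.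
  have widen_lift (j : 'I_n) : widen_ord (leqnSn n) j = lift ord_max j.
    by apply/val_inj; rewrite /= /bump leqNgt ltn_ord.
  under eq_bigr => j _ do rewrite widen_lift liftK -widen_lift.
  by move=> /(_ Lc (widen_ord (leqnSn n) i)); rewrite widen_lift liftK.
have [C C0 hC] : exists2 C : R, 0 <= C &
  forall c i, absR (c i) <= C * normR (L c) := IH e' free_e'.
have [d d0 hd] : exists2 d : R, 0 < d & forall c, d <= normR (u - L c).
  apply: contrapT => nd.
  have C1 : 0 < 2 * (C + 1) by lra.
  pose r (m : nat) : R := 2^-1 ^+ m.
  have r0 m : 0 < r m by rewrite exprn_gt0.
  have rS m : r m.+1 = r m / 2 by rewrite /r exprSr.
  (* The factor [2 * (C + 1)] makes consecutive combinations differ by at most [r m / (C + 1)]; by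
     [hC] their coordinates move by at most [r m], so they converge, and the limit puts [u] in the
     span. *)
  have /choice[c hc] : forall m, exists c, normR (u - L c) < r m / (2 * (C + 1)).
    move=> m; apply: contrapT => nc; apply: nd.
    exists (r m / (2 * (C + 1))); first by rewrite divr_gt0.
    by move=> c; rewrite leNgt; apply/negP => h; apply: nc; exists c.
  have /choice[l hl] : forall i, exists a : K^o, forall m, normR (a - c m i : K^o) <= 2 * r m.
    move=> i; apply: (compK (fun m => c m i)); split=> [//|m|m]; first by rewrite rS.
    have := hC (fun i => c m.+1 i - c m i) i; move/le_trans; apply.
    rewrite LB.
    have h1 := hc m; have h2 := hc m.+1.
    have h3 : normR (L (c m.+1) - L (c m)) <= r m / (C + 1).
      rewrite (le_trans (normR_dist_triangle u _ _))// normR_distC.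
      move: h1 h2; rewrite !ltr_pdivlMr ?ler_pdivlMr//; last lra.
      by rewrite rS; have := r0 m; nra.
    move: h3; rewrite ler_pdivlMr; last lra.
    by have := normR_ge0 (L (c m.+1) - L (c m)); nra.
  suff /eqP : u - L l = 0.
    rewrite subr_eq0 => /eqP uL.
    have := free_e (fun j => if unlift ord_max j is Some j' then l j' else - 1).
    rewrite big_ord_recr/= unlift_none scaleN1r.
    have widen_lift (j : 'I_n) : widen_ord (leqnSn n) j = lift ord_max j.
      by apply/val_inj; rewrite /= /bump leqNgt ltn_ord.
    under eq_bigr => j _ do rewrite widen_lift liftK -widen_lift.
    rewrite -/(L l) -/u -uL subrr => /(_ erefl ord_max).
    by rewrite unlift_none => /eqP; rewrite oppr_eq0 oner_eq0.
  apply/normR0_eq0/eqP; rewrite eq_le normR_ge0 andbT leNgt; apply/negP => pos.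
  (* For every [m], [u] is within [r m] of [L (c m)], which is within [r m * B] of [L l] by the
     coordinate errors. *)
  pose B := \sum_(i < n) 2 * normR (e' i).
  have B0 : 0 <= B by rewrite sumr_ge0// => i _; rewrite mulr_ge0// normR_ge0.
  have rr m : r m.+1 <= r m / 2 by rewrite rS.
  have B1 : 0 < 1 + B by rewrite ltr_pwDl.
  have [m hm] := halving_small rr (divr_gt0 pos B1).
  have := hm _ (leqnn m); rewrite ltr_pdivlMr// mulrDr mulr1.
  rewrite ltNge => /negP; apply.
  rewrite (le_trans (normR_dist_triangle (L (c m)) _ _))// lerD//.
    rewrite (le_trans (ltW (hc m)))// ler_pdivrMr// ler_peMr ?(ltW (r0 m))//; lra.
  rewrite -LB (le_trans (normR_sum _))// /B mulr_sumr; apply: ler_sum => i _.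
  rewrite normRZ mulrA ler_wpM2r ?normR_ge0// mulrC.
  by have := hl i m; rewrite normR_distC.
(* Factoring out a nonzero last coordinate leaves [u] minus an element of the span, of norm at least
   [d]. *)
have lip_max c : absR (c ord_max) * d <= normR (\sum_(i < n.+1) c i *: e i).
  have [->|c0] := eqVneq (c ord_max) 0; first by rewrite absR0 mul0r normR_ge0.
  have -> : \sum_(i < n.+1) c i *: e i = c ord_max *:
      (u - L (fun i => - (c (widen_ord (leqnSn n) i) / c ord_max))).
    rewrite scalerBr big_ord_recr/= addrC; congr (_ + _).
    rewrite -scalerN /L -sumrN scaler_sumr; apply: eq_bigr => i _.
    by rewrite scaleNr opprK scalerA mulrCA mulfV// mulr1.
  by rewrite normRZ ler_wpM2l ?absR_ge0.
(* [d^-1] serves the last coordinate; the other constant applies [hC] after subtracting the last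
   term, whose norm is at most [d^-1 * normR u] times that of the whole sum. *)
exists (Num.max d^-1 (C * (1 + d^-1 * normR u))).
  by rewrite le_max invr_ge0 (ltW d0).
move=> c i; case: (unliftP ord_max i) => [j ->|->]; last first.
  rewrite (@le_trans _ _ (d^-1 * normR (\sum_(i < n.+1) c i *: e i)))//.
    by rewrite ler_pdivlMl// mulrC.
  by rewrite ler_wpM2r ?normR_ge0// le_max lexx.
set S := normR (\sum_(i < n.+1) c i *: e i).
have SE : S = normR (L (fun i => c (widen_ord (leqnSn n) i)) + c ord_max *: u).
  by rewrite -[in RHS]/(e ord_max); congr normR; rewrite big_ord_recr.
rewrite (@le_trans _ _ (C * (1 + d^-1 * normR u) * S))//; last first.
  by rewrite ler_wpM2r ?normR_ge0// le_max lexx orbT.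
have -> : lift ord_max j = widen_ord (leqnSn n) j.
  by apply/val_inj; rewrite /= /bump leqNgt ltn_ord.
rewrite (le_trans (hC (fun i => c (widen_ord (leqnSn n) i)) j))//.
rewrite -mulrA ler_wpM2l// mulrDl mul1r.
rewrite -[X in normR X](addrK (c ord_max *: u)) (le_trans (ler_normRB _ _))//.
rewrite -SE lerD// normRZ mulrAC ler_wpM2r ?normR_ge0//.
by rewrite ler_pdivlMl// mulrC lip_max.
Qed.

End normed_spaces.

(** In the complex case the real and imaginary parts are dominated by the modulus, hence converge,
    and the modulus is at most the sum of their absolute values. *)
Lemma scalar_field_fast_complete (R : realType) (k : scalar_kind) :
  fast_complete (scalar_field R k)^o.
Proof.
case: k => [s r gs|s r gs].
  exact: (@complete_fast_complete R RealScalars R^o s r gs).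
have absRE (z : R[i]) :
    @normR R ComplexScalars (R[i])^o z = Num.sqrt (complex.Re z ^+ 2 + complex.Im z ^+ 2).
  by case: z.
have [r0 rS sS] := gs.
have Re_le (z : R[i]) : `|complex.Re z| <= @normR R ComplexScalars (R[i])^o z.
  by rewrite absRE -sqrtr_sqr ler_wsqrtr// lerDl sqr_ge0.
have Im_le (z : R[i]) : `|complex.Im z| <= @normR R ComplexScalars (R[i])^o z.
  by rewrite absRE -sqrtr_sqr ler_wsqrtr// lerDr sqr_ge0.
have le_ReIm (z : R[i]) :
    @normR R ComplexScalars (R[i])^o z <= `|complex.Re z| + `|complex.Im z|.
  rewrite absRE -[leRHS]ger0_norm ?addr_ge0// -sqrtr_sqr ler_wsqrtr//.
  rewrite sqrrD !real_normK ?num_real// lerD2r lerDl mulrn_wge0// mulr_ge0//.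
have part_lim (p : R[i] -> R) : (forall x y, p (x - y) = p x - p y) ->
    (forall z, `|p z| <= @normR R ComplexScalars (R[i])^o z) ->
    exists a : R, forall n, `|a - p (s n)| <= 2 * r n.
  move=> pB p_le.
  apply: (@complete_fast_complete R RealScalars R^o (p \o s)).
  by split=> // n; rewrite (le_trans _ (sS n))// -[normR _]/`|_| -pB.
have [|a ha] := part_lim (@complex.Re R) _ Re_le; first by case=> ? ? [].
have [|b hb] := part_lim (@complex.Im R) _ Im_le; first by case=> ? ? [].
exists (Complex a b); apply: (fast_cauchy_lim gs) => e e0.
have [n hn] := halving_small rS (divr_gt0 e0 (ltr0Sn _ 3)).
exists n => m /hn rm; rewrite (le_trans (le_ReIm _))//.
have := ha m; have := hb m.
by case: (s m) => x y /=; lra.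
Qed.

(** * Uniform boundedness for families of seminorms *)

Section uniform_boundedness.
Context (R : realType) (k : scalar_kind).
Local Notation K := (scalar_field R k).
Implicit Types V W : normedModType K.

Definition seminorm V (p : V -> R) :=
  (forall f g, p (f + g) <= p f + p g) /\ (forall a f, p (a *: f) = absR a * p f).

(** Lower semicontinuity replaces continuity here because it can be checked for [f |-> normR (T f)]
    before [T] is known to be continuous. *)
Definition norm_lsc V (p : V -> R) := forall f M, M < p f ->
  exists2 d : R, 0 < d & forall g, normR (g - f) <= d -> M < p g.

Lemma seminorm_lsc V (p : V -> R) C : seminorm p ->
  (forall f, p f <= C * normR f) -> norm_lsc p.
Proof.
move=> [pD pZ] pC f M Mp.
have C1 : 0 < `|C| + 1 by rewrite ltr_pwDr.
exists ((p f - M) / 2 / (`|C| + 1)) => [|g]; first by rewrite !divr_gt0 ?subr_gt0.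
rewrite ler_pdivlMr// => hg.
have h1 := pD g (f - g); rewrite addrC subrK in h1.
have h2 := pC (f - g); rewrite normR_distC in h2.
have h3 : C * normR (g - f) <= normR (g - f) * (`|C| + 1).
  rewrite mulrC ler_wpM2l ?normR_ge0// (le_trans (ler_norm _))// lerDl//.
by lra.
Qed.

(* Each step of the sequence leaves the previous ball only slightly and forces
   some [p i] to exceed [n] on a whole smaller ball. *)
Lemma uniform_boundedness V (I : Type) (p : I -> V -> R) :
  fast_complete V -> (forall i, seminorm (p i)) ->
  (forall i, norm_lsc (p i)) ->
  (forall f, exists M, forall i, p i f <= M) ->
  exists2 C, 0 <= C & forall i f, p i f <= C * normR f.
Proof.
move=> compV pS plsc pb; apply: contrapT => nC.
have unb B : 0 <= B -> exists i f, B * normR f < p i f.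
  move=> B0; apply: contrapT => nB; apply: nC; exists B => // i f.
  by rewrite leNgt; apply/negP => h; apply: nB; exists i, f.
pose st := (nat * V * {r : R | 0 < r})%type.
pose step (x y : st) := [/\ y.1.1 = x.1.1.+1, normR (y.1.2 - x.1.2) <= val x.2,
  val y.2 <= val x.2 / 2 &
  forall g, normR (g - y.1.2) <= 2 * val y.2 -> exists i, x.1.1%:R < p i g].
have stepP x : {y | step x y}.
  case: x => -[n s] [r r0]; apply: cid.
  have [M sM] := pb s.
  (* With this factor, [p i] exceeds [n + |M|] on a multiple of [f] of norm [r]; since [p i s <= M],
     it exceeds [n] at the shifted centre. *)
  have B0 : 0 <= (n%:R + `|M|) / r by rewrite divr_ge0 ?addr_ge0// ltW.
  have [i [f hf]] := unb _ B0; have [pD pZ] := pS i.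
  have pN0 : 0 <= p i f by rewrite (le_trans _ (ltW hf))// mulr_ge0 ?normR_ge0.
  have f0 : f != 0.
    apply/eqP => f0; move: hf; rewrite f0 normR0 mulr0.
    by have := pZ 0 0; rewrite scale0r absR0 mul0r => ->; rewrite ltxx.
  have nf0 := normR_gt0 f0.
  pose a : K := scalar_of_real k (r / normR f).
  have aE : absR a = r / normR f by rewrite absR_scalar_of_real// divr_ge0// ltW.
  have big : n%:R < p i (s + a *: f).
    have := pD (s + a *: f) (- s); rewrite addrAC subrr add0r pZ aE.
    rewrite -scaleN1r pZ /absR normrN -/(absR 1) absR1 mul1r.
    have := sM i; have := ler_norm M.
    have : n%:R + `|M| < r / normR f * p i f.
      rewrite mulrAC ltr_pdivlMr// -ltr_pdivrMl// mulrA.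
      by rewrite (mulrC r^-1).
    by lra.
  have [d d0 hd] := plsc i _ _ big.
  (* [r / 2] keeps the rates halving; [d / 2] is used because the limit is only known to lie within
     twice the radius. *)
  have r'0 : 0 < Num.min (r / 2) (d / 2) by rewrite lt_min !divr_gt0.
  exists (n.+1, s + a *: f, exist (fun r : R => 0 < r) _ r'0); split => //=.
  - by rewrite addrAC subrr add0r normRZ aE divfK// gt_eqF.
  - by rewrite ge_min lexx.
  - move=> g hg; exists i; apply: hd; rewrite (le_trans hg)//.
    rewrite mulrC -ler_pdivlMr// ge_min; apply/orP; right; exact: lexx.
have [F [F0 FS]] := dependent_choice stepP (0%N, 0, exist (fun r : R => 0 < r) 1 ltr01).
have [|v hv] := compV (fun n => (F n).1.2) (fun n => val (F n).2).
  by split=> n; [exact: (valP (F n).2)|have [] := FS n|have [] := FS n].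
have Fn n : (F n).1.1 = n by elim: n => [|n IH]; [rewrite F0|have [->] := FS n; rewrite IH].
have [M hM] := pb v.
have [_ _ _ /(_ v (hv _)) [i h]] := FS (Num.bound `|M|).
rewrite Fn in h.
have := archi_boundP (normr_ge0 M); rewrite ltNge => /negP; apply.
by rewrite (le_trans (ltW h))// (le_trans (hM i))// ler_norm.
Qed.

End uniform_boundedness.

(** * Function spaces and common zeros *)

(** The triangle inequality is stated as [dist_contract], the Lipschitz property of [D z], since
    distances serve as building blocks of functions; the case [z = y] gives symmetry. *)
Record bounded_distance (R : realType) (X : Type) (D : X -> X -> R) := BoundedDistance {
  dist_ge0 : forall x y, 0 <= D x y;
  dist_eq0 : forall x y, D x y = 0 <-> x = y;
  dist_contract : forall z x y, `|D z x - D z y| <= D x y;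
  dist_bounded : exists M, forall x y, D x y <= M }.

(* [D] is a bare function because the points of a [compact_set] carry no metric
   structure. *)
Record function_space (R : realType) (k : scalar_kind) (X : eqType) (D : X -> X -> R)
    (V E : normedModType (scalar_field R k)) (ev : V -> X -> E) := FunctionSpace {
  ev_linear : forall a f g x, ev (a *: f + g) x = a *: ev f x + ev g x;
  ev_le : forall f x, normR (ev f x) <= normR f;
  fs_complete : fast_complete V;
  (* The balls of [V] are closed for pointwise convergence. *)
  fs_ball_closed : forall f M, (forall (l : seq X) d, 0 < d -> exists2 g, normR g <= M &
    {in l, forall x, normR (ev g x - ev f x) <= d}) -> normR f <= M;
  fs_lipschitz : exists2 C, 0 <= C & forall (h : X -> E) L, 0 <= L ->
    (forall x, normR (h x) <= L) -> (forall x y, normR (h x - h y) <= L * D x y) ->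
    exists2 f, ev f =1 h & normR f <= C * L;
  fs_continuous : forall f x e, 0 < e -> exists2 d, 0 < d &
    forall y, D x y < d -> normR (ev f x - ev f y) <= e }.

Section function_space_theory.
Context (R : realType) (k : scalar_kind) (X : eqType) (D : X -> X -> R).
Context (V E : normedModType (scalar_field R k)) (ev : V -> X -> E).
Hypotheses (distD : bounded_distance D) (fs : function_space D ev).

Lemma ev0 x : ev 0 x = 0.
Proof. by have := ev_linear fs (-1) 0 0 x; rewrite !scaleN1r !addNr. Qed.

Lemma evD f g x : ev (f + g) x = ev f x + ev g x.
Proof. by have := ev_linear fs 1 f g x; rewrite !scale1r. Qed.

Lemma evZ a f x : ev (a *: f) x = a *: ev f x.
Proof. by have := ev_linear fs a f 0 x; rewrite !addr0 ev0 addr0. Qed.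

Lemma evB f g x : ev (f - g) x = ev f x - ev g x.
Proof. by rewrite evD -scaleN1r evZ scaleN1r. Qed.

Lemma ev_sum n (c : 'I_n -> scalar_field R k) (f : 'I_n -> V) x :
  ev (\sum_(i < n) c i *: f i) x = \sum_(i < n) c i *: ev (f i) x.
Proof.
rewrite (big_morph (ev^~ x) (fun f g => evD f g x) (ev0 x)).
by apply: eq_bigr => i _; rewrite evZ.
Qed.

(** The zero element agrees with [f] everywhere, so [f] belongs to the closed ball of radius 0. *)
Lemma ev_inj f : (forall x, ev f x = 0) -> f = 0.
Proof.
move=> f0; apply/normR0_eq0/eqP; rewrite eq_le normR_ge0 andbT.
apply: (fs_ball_closed fs) => l d d0; exists 0; first by rewrite normR0.
by move=> x _; rewrite f0 ev0 subrr normR0 ltW.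
Qed.

(** [C] is fixed before [e]: the gliding hump needs a bound that is uniform in the direction. *)
Lemma scalar_multiple (phi : X -> R) L : 0 <= L ->
  (forall x, `|phi x| <= L) -> (forall x y, `|phi x - phi y| <= L * D x y) ->
  exists2 C, 0 <= C & forall e, exists2 f : V,
    forall x, ev f x = scalar_of_real k (phi x) *: e & normR f <= C * normR e.
Proof.
have absE x : absR (scalar_of_real k x) = `|x|.
  have [x0|x0] := leP 0 x; first by rewrite absR_scalar_of_real// ger0_norm.
  have e0 : scalar_of_real k x = - scalar_of_real k (- x).
    by apply/eqP; rewrite -addr_eq0 -scalar_of_realD subrr scalar_of_real0.
  rewrite e0 /absR normrN -/(absR _) absR_scalar_of_real ?oppr_ge0 ?ltW//.
  by rewrite ltr0_norm.
move=> L0 phiL phiD; have [C C0 hC] := fs_lipschitz fs.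
exists (C * L) => [|e]; first exact: mulr_ge0.
have [|x|x y|f fE fC] := hC (fun x => scalar_of_real k (phi x) *: e) (L * normR e).
- by rewrite mulr_ge0 ?normR_ge0.
- by rewrite normRZ absE ler_wpM2r ?normR_ge0.
- rewrite -scalerBl normRZ.
  have -> : scalar_of_real k (phi x) - scalar_of_real k (phi y) =
      scalar_of_real k (phi x - phi y).
    by apply/eqP; rewrite subr_eq -scalar_of_realD subrK.
  by rewrite absE mulrAC ler_wpM2r ?normR_ge0.
- by exists f; [exact: fE|rewrite -mulrA].
Qed.

Lemma peak x (e : E) : e != 0 -> exists f, forall y, ev f y = 0 <-> y = x.
Proof.
move=> e0; have [M hM] := dist_bounded distD.
(* [M] bounds the values of [D x], and 1 is its Lipschitz constant. *)
have [|y|y z|C C0 hC] := @scalar_multiple (D x) (Num.max M 1).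
- by rewrite le_max ler01 orbT.
- by rewrite ger0_norm ?(dist_ge0 distD)// le_max hM.
- rewrite (le_trans (dist_contract distD _ _ _))// ler_peMl ?(dist_ge0 distD)//.
  by rewrite le_max lexx orbT.
- have [f fE _] := hC e; exists f => y; rewrite fE; split=> [/eqP|->].
    rewrite scaler_eq0 (negPf e0) orbF -(scalar_of_real0 R k).
    by rewrite (inj_eq (can_inj (@scalar_of_realK R k))) => /eqP/(dist_eq0 distD).
  by have /(dist_eq0 distD) -> := erefl x; rewrite scalar_of_real0 scale0r.
Qed.

(** [phi] is the product over the points [a] of [l] of the normalised distances [D a y / D a x];
    products of bounded Lipschitz functions are again such. *)
Lemma separating_scalar (l : seq X) x : x \notin l -> exists (phi : X -> R) (L : R),
  [/\ 0 <= L, phi x = 1, {in l, forall y, phi y = 0}, forall y, `|phi y| <= L &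
      forall y z, `|phi y - phi z| <= L * D y z].
Proof.
elim: l => [_|a l IH].
  exists (fun=> 1), 1; split=> // [y|y z]; first by rewrite normr1.
  by rewrite subrr normr0 mul1r (dist_ge0 distD).
rewrite inE negb_or => /andP[xa /IH[phi [L [L0 phix phil phiL phiD]]]].
have [M hM] := dist_bounded distD.
have dax : 0 < D a x.
  rewrite lt_neqAle (dist_ge0 distD) andbT eq_sym; apply/eqP => /(dist_eq0 distD).
  by move=> ax; rewrite ax eqxx in xa.
have M0 : 0 < M := lt_le_trans dax (hM _ _).
(* One constant for both bounds on [psi]: [M / D a x] for its values and [1 / D a x] for its
   differences. *)
pose A := (M + 1) / D a x.
have A0 : 0 < A by rewrite divr_gt0// addr_gt0.
pose psi y := D a y / D a x.
have psiA y : `|psi y| <= A.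
  rewrite normrM ger0_norm ?(dist_ge0 distD)// gtr0_norm ?invr_gt0//.
  by rewrite ler_pM2r ?invr_gt0// (le_trans (hM _ _))// lerDl.
have psiD y z : `|psi y - psi z| <= A * D y z.
  rewrite -mulrBl normrM (@gtr0_norm _ (D a x)^-1) ?invr_gt0//.
  rewrite mulrAC ler_pM2r ?invr_gt0// (le_trans (dist_contract distD _ _ _))//.
  by rewrite ler_peMl ?(dist_ge0 distD)// lerDr ltW.
(* The factor 2 comes from the two terms of the product rule. *)
exists (fun y => phi y * psi y), (2 * (L * A)); split.
- by have := mulr_ge0 L0 (ltW A0); lra.
- by rewrite phix mul1r /psi divff// gt_eqF.
- move=> y; rewrite inE => /orP[/eqP ->|/phil ->]; last by rewrite mul0r.
  by rewrite /psi; have /(dist_eq0 distD) -> := erefl a; rewrite mul0r mulr0.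
- move=> y; rewrite normrM; have LA : `|phi y| * `|psi y| <= L * A.
    by rewrite ler_pM.
  by have := mulr_ge0 L0 (ltW A0); lra.
- move=> y z.
  have -> : phi y * psi y - phi z * psi z =
      (phi y - phi z) * psi y + phi z * (psi y - psi z).
    by rewrite mulrBl mulrBr addrA subrK.
  rewrite (le_trans (ler_normD _ _))// (normrM _ (psi y)) (normrM (phi z)).
  have h1 : `|phi y - phi z| * `|psi y| <= (L * D y z) * A by rewrite ler_pM.
  have h2 : `|phi z| * `|psi y - psi z| <= L * (A * D y z) by rewrite ler_pM.
  have -> : 2 * (L * A) * D y z = L * D y z * A + L * (A * D y z) by ring.
  exact: lerD.
Qed.

Lemma interpolate (l : seq X) x : x \notin l -> exists2 C, 0 <= C & forall e,
  exists f : V, [/\ ev f x = e, {in l, forall y, ev f y = 0} & normR f <= C * normR e].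
Proof.
move=> /separating_scalar[phi [L [L0 phix phil phiL phiD]]].
have [C C0 hC] := scalar_multiple L0 phiL phiD.
exists C => // e; have [f fE fC] := hC e; exists f; split=> //.
  by rewrite fE phix scalar_of_real1 scale1r.
by move=> y /phil yl; rewrite fE yl scalar_of_real0 scale0r.
Qed.

(** Contrapositive of [fs_ball_closed]: a norm above [M] is already detected by finitely many
    approximate values. *)
Lemma ev_lsc : forall f M, M < normR f -> exists (l : seq X) (d : R), 0 < d /\
  forall g, {in l, forall x, normR (ev g x - ev f x) <= d} -> M < normR g.
Proof.
move=> f M Mf; apply: contrapT => nl; move: Mf; rewrite ltNge => /negP; apply.
apply: (fs_ball_closed fs) => l d d0; apply: contrapT => ng; apply: nl.
exists l, d; split=> // g gf; rewrite ltNge; apply/negP => gM; apply: ng.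
by exists g.
Qed.

End function_space_theory.

(** * Common zeros and the induced map of points *)

Section common_zeros.
Context (R : realType) (k : scalar_kind) (X Y : eqType).
Context (DX : X -> X -> R) (DY : Y -> Y -> R).
Context (V E W F : normedModType (scalar_field R k)).
Context (evX : V -> X -> E) (evY : W -> Y -> F).
Hypotheses (distX : bounded_distance DX) (fsX : function_space DX evX).
Hypotheses (distY : bounded_distance DY) (fsY : function_space DY evY).

Definition common_zeros_preserving (T : V -> W) := forall f g,
  (exists x, evX f x = 0 /\ evX g x = 0) <->
  (exists y, evY (T f) y = 0 /\ evY (T g) y = 0).

(** Let [f0] peak at [x] and let [y] be a zero of [T f0]. If [f] vanishes at [x], then [T f0] and
    [T f] share a zero [z]. Preimages [g1], [g2] of peaks at [y] and [z] each share a zero with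
    [f0], so both vanish at [x]; hence the two peaks share a zero and [y = z]. *)
Lemma common_zeros_point (T : V -> W) (e : E) (v : F) : e != 0 -> v != 0 ->
  (forall g, exists f, T f = g) -> common_zeros_preserving T ->
  forall x, exists y, forall f, evX f x = 0 -> evY (T f) y = 0.
Proof.
move=> e0 v0 surjT TP x; have [f0 f0P] := peak distX fsX x e0.
have f0x : evX f0 x = 0 by apply/f0P.
have peakT y : exists g, forall z, evY (T g) z = 0 <-> z = y.
  have [w wP] := peak distY fsY y v0; have [g gw] := surjT w.
  by exists g; rewrite gw.
have vanish g y : (forall z, evY (T g) z = 0 <-> z = y) -> evY (T f0) y = 0 ->
    evX g x = 0.
  move=> gP f0y; have [|z [gz /f0P <-]//] := (TP g f0).2.
  by exists y; split=> //; apply/gP.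
have [y [f0y _]] := (TP f0 f0).1 (ex_intro _ x (conj f0x f0x)).
exists y => f fx; have [z [f0z fz]] := (TP f0 f).1 (ex_intro _ x (conj f0x fx)).
have [g1 g1P] := peakT y; have [g2 g2P] := peakT z.
have [u [/g1P uy /g2P uz]] := (TP g1 g2).1
  (ex_intro _ x (conj (vanish _ _ g1P f0y) (vanish _ _ g2P f0z))).
by rewrite -uy uz.
Qed.

End common_zeros.

Section automatic_continuity.
Context (R : realType) (k : scalar_kind) (X Y : eqType).
Context (DX : X -> X -> R) (DY : Y -> Y -> R).
Context (V E W F : normedModType (scalar_field R k)).
Context (evX : V -> X -> E) (evY : W -> Y -> F).
Hypotheses (distX : bounded_distance DX) (fsX : function_space DX evX).
Hypotheses (distY : bounded_distance DY) (fsY : function_space DY evY).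

(** The point lemma for the inverse gives [h]; for [T] at [h y] it gives some [z], and a peak at [y]
    forces [z = y]. Peaks give injectivity in the same way. *)
Lemma common_zeros_map (T : V -> W) (e : E) (v : F) : e != 0 -> v != 0 ->
  bijective T -> common_zeros_preserving evX evY T ->
  exists2 h : Y -> X, injective h &
    forall f y, evX f (h y) = 0 <-> evY (T f) y = 0.
Proof.
move=> e0 v0 [S TK SK] TP.
have T_surj g : exists f, T f = g by exists (S g); rewrite SK.
have S_surj f : exists g, S g = f by exists (T f); rewrite TK.
have SP : common_zeros_preserving evY evX S.
  by move=> f g; have [h1 h2] := TP (S f) (S g); rewrite !SK in h1 h2; split.
have /choice[h hP] := common_zeros_point distY fsY distX fsX v0 e0 S_surj SP.
have hP' f y : evY (T f) y = 0 -> evX f (h y) = 0 by move/hP; rewrite TK.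
have zeroP f y : evX f (h y) = 0 <-> evY (T f) y = 0.
  split=> [|/hP'//]; move: f.
  have [z hz] := common_zeros_point distX fsX distY fsY e0 v0 T_surj TP (h y).
  have [w wP] := peak distY fsY y v0; have [g gw] := T_surj w.
  suff zy : z = y by move=> f; rewrite -{2}zy; exact: hz.
  by apply/wP; rewrite -gw; apply/hz/hP'; rewrite gw; apply/wP.
exists h => // y z yz.
have [w wP] := peak distY fsY z v0; have [g gw] := T_surj w.
by apply/wP; rewrite -gw; apply/zeroP; rewrite yz; apply/zeroP; rewrite gw; apply/wP.
Qed.

(** * Boundedness of the fibre maps *)

Section weighted_composition.
Context (T : {linear V -> W}) (h : Y -> X).
Hypotheses (h_inj : injective h).
Hypothesis (hT : forall f y, evX f (h y) = 0 -> evY (T f) y = 0).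

(** By [hT], [evX f (h y) |-> evY (T f) y] is a well-defined linear map on values; this is its
    boundedness, stated without constructing it. *)
Definition fiber_bounded y := exists2 C, 0 <= C &
  forall f, normR (evY (T f) y) <= C * normR (evX f (h y)).

Lemma fiber_ext f g y : evX f (h y) = evX g (h y) -> evY (T f) y = evY (T g) y.
Proof.
move=> fg; apply/eqP; rewrite -subr_eq0 -(evB fsY) -linearB/=; apply/eqP/hT.
by rewrite (evB fsX) fg subrr.
Qed.

(** Lift a basis of [E] to functions [f i]. Then [T g y] is the combination of the [T (f i) y] with
    the coordinates of [g (h y)], and these are bounded by [free_coord_bound]. *)
Lemma finite_dim_fiber_bounded n : has_dim E n -> forall y, fiber_bounded y.
Proof.
move=> [e [free_e gen_e]] y.
have [C C0 hC] :=
  free_coord_bound (@scalar_field_fast_complete R k) free_e.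
have [C1 _ interp] := interpolate distX fsX (isT : h y \notin [::]).
have /choice[f fe] : forall i, exists f, evX f (h y) = e i.
  by move=> i; have [f [fE _ _]] := interp (e i); exists f.
exists (\sum_(i < n) C * normR (evY (T (f i)) y)) => [|g].
  by apply: sumr_ge0 => i _; rewrite mulr_ge0 ?normR_ge0.
have [c gc] := gen_e (evX g (h y)).
have -> : evY (T g) y = \sum_(i < n) c i *: evY (T (f i)) y.
  rewrite -(ev_sum fsY c (fun i => T (f i))).
  have -> : \sum_(i < n) c i *: T (f i) = T (\sum_(i < n) c i *: f i).
    by rewrite linear_sum; apply: eq_bigr => i _; rewrite linearZ.
  by apply: fiber_ext; rewrite (ev_sum fsX) gc; apply: eq_bigr => i _; rewrite fe.
rewrite (le_trans (normR_sum _))// mulr_suml; apply: ler_sum => i _.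
by rewrite normRZ mulrAC ler_wpM2r ?normR_ge0// gc.
Qed.

(* If infinitely many fibers were unbounded, a series of small functions, each
   vanishing at the points already treated, would have an unbounded image. *)
Lemma fiber_bounded_cofinite : exists l : seq Y, forall y, y \notin l -> fiber_bounded y.
Proof.
apply: contrapT => nl.
have bad (l : seq Y) : exists2 y, y \notin l & ~ fiber_bounded y.
  apply: contrapT => nb; apply: nl; exists l => y yl; apply: contrapT => yb.
  by apply: nb; exists y.
(* A state holds the stage, the partial sum and the points already treated. *)
pose st := (nat * V * seq Y)%type.
pose r (n : nat) : R := 2^-1 ^+ n.
have r0 n : 0 < r n by rewrite exprn_gt0.
have rS n : r n.+1 <= r n / 2 by rewrite /r exprSr.
pose step (x z : st) := [/\ z.1.1 = x.1.1.+1, normR (z.1.2 - x.1.2) <= r x.1.1,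
  {in x.2, forall y, evX z.1.2 (h y) = evX x.1.2 (h y)} &
  exists2 y, z.2 = y :: x.2 & x.1.1%:R <= normR (evY (T z.1.2) y)].
have stepP x : {z | step x z}.
  case: x => -[n s] l; apply: cid; have [y yl yb] := bad l.
  have hyl : h y \notin [seq h z | z <- l] by rewrite mem_map.
  have [C C0 interp] := interpolate distX fsX hyl.
  (* Chosen so that the correction of size at most [r n] has an image at [y] of norm at least
     [n + normR (T s y)], which leaves at least [n] after adding [T s y]. *)
  pose B := (C + 1) * (n%:R + normR (evY (T s) y)) / r n.
  have C1 : 0 < C + 1 by rewrite ltr_pwDr.
  have B0 : 0 <= B.
    by rewrite divr_ge0 ?(ltW (r0 n))// mulr_ge0 ?(ltW C1)// addr_ge0// normR_ge0.
  have [f hf] : exists f, B * normR (evX f (h y)) < normR (evY (T f) y).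
    apply: contrapT => nf; apply: yb; exists B => // f; rewrite leNgt; apply/negP => hf.
    by apply: nf; exists f.
  have e0 : evX f (h y) != 0.
    apply/eqP => e0; move: hf; rewrite e0 normR0 mulr0.
    by rewrite hT// normR0 ltxx.
  have ne0 := normR_gt0 e0.
  (* [f1] replaces [f]: it has the same value at [h y], hence the same image at [y], but a
     controlled norm and zeros at the treated points. *)
  have [f1 [f1y f1l f1N]] := interp (evX f (h y)).
  pose t := r n / ((C + 1) * normR (evX f (h y))).
  have t0 : 0 < t by rewrite divr_gt0// mulr_gt0.
  have tE : absR (scalar_of_real k t) = t by rewrite absR_scalar_of_real// ltW.
  exists (n.+1, s + scalar_of_real k t *: f1, y :: l); split=> //=.
  - rewrite addrAC subrr add0r normRZ tE /t mulrAC ler_pdivrMr ?mulr_gt0//.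
    rewrite ler_pM2l// (le_trans f1N)// ler_wpM2r ?normR_ge0// lerDl//.
  - move=> z zl; rewrite (evD fsX) (evZ fsX) f1l ?scaler0 ?addr0//.
    exact: map_f.
  - exists y => //; rewrite linearD linearZ/= (evD fsY) (evZ fsY) (fiber_ext f1y).
    have h1 : n%:R + normR (evY (T s) y) <= t * normR (evY (T f) y).
      rewrite /t mulrAC ler_pdivlMr ?mulr_gt0//.
      move: hf; rewrite /B mulrAC ltr_pdivrMr// => /ltW.
      by rewrite (mulrC (normR _) (r n)) mulrA (mulrC _ (C + 1)).
    have := ler_normRB (evY (T s) y + scalar_of_real k t *: evY (T f) y) (evY (T s) y).
    by rewrite addrAC subrr add0r normRZ tE; lra.
have [G [G0 GS]] := dependent_choice stepP (0%N, 0, [::]).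
have Gn n : (G n).1.1 = n.
  by elim: n => [|n IH]; [rewrite G0|have [-> _ _ _] := GS n; rewrite IH].
have gs : fast_cauchy (fun n => (G n).1.2) r.
  by split=> // n; have [_ + _ _] := GS n; rewrite Gn.
have [v hv] := fs_complete fsX gs.
pose M := normR (T v).
have [_ _ _ [y yl]] := GS (Num.bound M); rewrite Gn.
set n := Num.bound M.
(* Later corrections vanish at [h y], so the value there is frozen and passes to [v]. At this stage
   the lower bound at [y] already exceeds [normR (T v)]. *)
have yG j : y \in (G (j + n.+1)%N).2 /\
    evX (G (j + n.+1)%N).1.2 (h y) = evX (G n.+1).1.2 (h y).
  elim: j => [|j [IHy IHe]]; first by rewrite add0n yl mem_head.
  have [_ _ keep [z zl _]] := GS (j + n.+1)%N; rewrite addSn zl in_cons IHy orbT.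
  by rewrite keep.
have vy : evX v (h y) = evX (G n.+1).1.2 (h y).
  apply/eqP; rewrite -subr_eq0; apply/eqP/normR0_eq0/eqP.
  rewrite eq_le normR_ge0 andbT; apply/ler_addgt0Pr => e e0; rewrite add0r.
  have [m hm] := halving_small rS (divr_gt0 e0 (ltr0Sn _ 1)).
  have [_ <-] := yG m; rewrite -(evB fsX) (le_trans (ev_le fsX _ _))//.
  rewrite (le_trans (hv _))//; have := hm (m + n.+1)%N (leq_addr _ _); lra.
rewrite -(fiber_ext vy) => /le_trans/(_ (ev_le fsY _ _)).
by rewrite leNgt archi_boundP// normR_ge0.
Qed.

(** Uniform boundedness for the single seminorm [normR (T f)]: by [ev_lsc] a value above [M] is
    witnessed at finitely many points, where evaluation is bounded by hypothesis. *)
Lemma pointwise_bounded_bounded :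
  (forall y, exists2 C, 0 <= C & forall f, normR (evY (T f) y) <= C * normR f) ->
  exists2 C, 0 <= C & forall f, normR (T f) <= C * normR f.
Proof.
move=> pb.
have nS : seminorm (fun f : V => normR (T f)).
  split=> [f g|a f]; first by rewrite linearD ler_normRD.
  by rewrite linearZ normRZ.
have [||||C C0 hC] := @uniform_boundedness R k V unit (fun _ f => normR (T f)).
- exact: fs_complete fsX.
- by [].
- move=> _ f M Mf; have [l [d [d0 hd]]] := ev_lsc fsY Mf.
  have [C C0 hC] : exists2 C, 0 <= C & {in l, forall y f,
      normR (evY (T f) y) <= C * normR f}.
    elim: {hd} l => [|y l [C C0 IH]]; first by exists 0.
    have [C' C'0 yC'] := pb y; exists (C + C'); first exact: addr_ge0.
    move=> z; rewrite inE => /orP[/eqP -> g|zl g].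
      by rewrite (le_trans (yC' _))// ler_wpM2r ?normR_ge0// lerDr.
    by rewrite (le_trans (IH z zl g))// ler_wpM2r ?normR_ge0// lerDl.
  have C1 : 0 < C + 1 by rewrite ltr_pwDr.
  exists (d / (C + 1)) => [|g gf]; first exact: divr_gt0.
  apply: hd => y yl; rewrite -(evB fsY) -linearB/= (le_trans (hC y yl _))//.
  move: gf; rewrite ler_pdivlMr// mulrC; apply: le_trans.
  by rewrite ler_wpM2r ?normR_ge0// lerDl.
- by move=> f; exists (normR (T f)).
by exists C => // f; exact: (hC tt).
Qed.

(** Off the finite set [l] the evaluations of [T f] are bounded for each [f] by [normR (T f)], so
    one constant [C] serves them all; it extends to [l] by continuity of [T f]. *)
Lemma perfect_fiber_bounded :
  (forall y d, 0 < d -> exists2 z, z != y & DY y z < d) ->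
  exists2 C, 0 <= C & forall y f, normR (evY (T f) y) <= C * normR f.
Proof.
move=> perfect; have [l hl] := fiber_bounded_cofinite.
have evS y : seminorm (fun f => normR (evY (T f) y)).
  split=> [f g|a f]; first by rewrite linearD (evD fsY) ler_normRD.
  by rewrite linearZ/= (evZ fsY) normRZ.
have [||||C C0 hC] := @uniform_boundedness R k V {y | y \notin l}
  (fun y f => normR (evY (T f) (val y))).
- exact: fs_complete fsX.
- by move=> y; exact: evS.
- move=> [y yl]/=; have [C C0 hC] := hl y yl.
  apply: (@seminorm_lsc _ _ _ _ C) => [|f]; first exact: evS.
  by rewrite (le_trans (hC f))// ler_wpM2l// (ev_le fsX).
- by move=> f; exists (normR (T f)) => y; exact: ev_le fsY _ _.
exists C => // y f; apply/ler_addgt0Pr => e e0.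
have [d d0 hd] := fs_continuous fsY (T f) y e0.
(* A radius [d'] within which no point of [l] other than [y] occurs, so the nearby [z] avoids
   [l]. *)
have [d' d'0 [d'd d'l]] : exists2 d', 0 < d' & d' <= d /\
    {in l, forall z, z != y -> d' <= DY y z}.
  elim: {hl hC} l => [|a l [d' d'0 [d'd d'l]]]; first by exists d.
  have [->|ay] := eqVneq a y.
    exists d' => //; split=> // z; rewrite inE => /orP[/eqP ->|/d'l//].
    by rewrite eqxx.
  exists (Num.min d' (DY y a)).
    rewrite lt_min d'0 lt_neqAle (dist_ge0 distY) andbT eq_sym.
    by apply: contra ay => /eqP/(dist_eq0 distY) ->.
  split; first by rewrite ge_min d'd.
  move=> z; rewrite inE ge_min => /orP[/eqP -> _|zl zy]; first by rewrite lexx orbT.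
  by rewrite d'l.
have [z zy zd] := perfect y d' d'0.
have zl : z \notin l.
  by apply/negP => zl; have := d'l z zl zy; rewrite leNgt zd.
have h1 := hC (exist (fun y => y \notin l) z zl) f; rewrite /= in h1.
have h2 := hd z (lt_le_trans zd d'd).
have := ler_normRD (evY (T f) y - evY (T f) z) (evY (T f) z).
by rewrite subrK; lra.
Qed.

End weighted_composition.
End automatic_continuity.

(** * The abstract continuity theorem *)

Section continuity_criterion.
Context (R : realType) (k : scalar_kind) (X Y : eqType).
Context (DX : X -> X -> R) (DY : Y -> Y -> R).
Context (V E W F : normedModType (scalar_field R k)).
Context (evX : V -> X -> E) (evY : W -> Y -> F).
Hypotheses (distX : bounded_distance DX) (fsX : function_space DX evX).
Hypotheses (distY : bounded_distance DY) (fsY : function_space DY evY).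

Lemma linear_continuous_le (T : {linear V -> W}) C : 0 <= C ->
  (forall f, normR (T f) <= C * normR f) -> continuous T.
Proof.
move=> C0 TC; apply: bounded_linear_continuous; apply/linear_boundedP.
have C0' : 0 <= scalar_of_real k C by rewrite -(scalar_of_real0 R k) scalar_of_real_le.
exists (scalar_of_real k C); split; first exact: ger0_real.
move=> c Cc f; apply: (@le_trans _ _ (scalar_of_real k C * `|f|)).
  by rewrite -!normRK -scalar_of_realM scalar_of_real_le.
by rewrite ler_wpM2r// ltW.
Qed.

Theorem common_zeros_continuous (T : {linear V -> W}) :
  bijective T -> common_zeros_preserving evX evY T ->
  same_finite_dim E F \/ (forall y d, 0 < d -> exists2 z, z != y & DY y z < d) ->
  continuous T.
Proof.
move=> bT TP dim_or_perfect.
(* Peaks require nonzero vectors, so zero [E] or [F] is treated apart: then [T] is zero. *)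
have T0 : (forall f, T f = 0) -> continuous T.
  by move=> Tf0; apply: (@linear_continuous_le T 0) => // f; rewrite Tf0 normR0 mul0r.
have [E0|/existsNP[e /eqP e0]] := pselect (forall e : E, e = 0).
  by apply: T0 => f; rewrite (_ : f = 0) ?linear0//; apply: (ev_inj fsX).
have [F0|/existsNP[v /eqP v0]] := pselect (forall v : F, v = 0).
  by apply: T0 => f; apply: (ev_inj fsY).
have [h h_inj hP] := common_zeros_map distX fsX distY fsY e0 v0 bT TP.
have hT f y : evX f (h y) = 0 -> evY (T f) y = 0 by move/hP.
suff pb y : exists2 C, 0 <= C & forall f, normR (evY (T f) y) <= C * normR f.
  by have [C C0 TC] := pointwise_bounded_bounded fsX fsY pb; exact: linear_continuous_le TC.
case: dim_or_perfect => [[n [dimE _]]|perfect].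
  have [C C0 hC] := finite_dim_fiber_bounded distX fsX fsY hT dimE y.
  by exists C => // f; rewrite (le_trans (hC f))// ler_wpM2l// (ev_le fsX).
have [C C0 hC] := perfect_fiber_bounded distX fsX distY fsY h_inj hT perfect.
by exists C.
Qed.

End continuity_criterion.

(** * Completeness through pointwise limits *)

Section completeness_criterion.
Context (R : realType) (k : scalar_kind) (X : eqType).
Context (V E : normedModType (scalar_field R k)) (ev : V -> X -> E).

Lemma fast_complete_pointwise : fast_complete E ->
  (forall a f g x, ev (a *: f + g) x = a *: ev f x + ev g x) ->
  (forall f x, normR (ev f x) <= normR f) ->
  (forall f M, (forall (l : seq X) d, 0 < d -> exists2 g, normR g <= M &
    {in l, forall x, normR (ev g x - ev f x) <= d}) -> normR f <= M) ->
  (forall s r (f : X -> E), fast_cauchy s r ->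
    (forall n x, normR (f x - ev (s n) x) <= 2 * r n) -> exists g, ev g =1 f) ->
  fast_complete V.
Proof.
move=> cE lin le closed lim s r gs; have [r0 rS sS] := gs.
have evBE f g x : ev (f - g) x = ev f x - ev g x.
  by rewrite addrC -scaleN1r lin scaleN1r addrC.
have /choice[f hf] x : exists v, forall n, normR (v - ev (s n) x) <= 2 * r n.
  apply: (cE (fun n => ev (s n) x)); split=> // n.
  by rewrite -evBE (le_trans (le _ _)).
have [g gf] := lim s r f gs (fun n x => hf x n).
exists g => n; apply: closed => l d d0.
have [m hm] := halving_small rS (divr_gt0 d0 (ltr0Sn _ 1)).
(* This difference lies in the ball of radius [2 * r n] by the tail estimate and is pointwise close
   to [g - s n]. *)
exists (s (maxn m n) - s n); first by apply: (fast_cauchy_tail gs); rewrite leq_maxr.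
move=> x _; rewrite !evBE opprB addrA subrK gf normR_distC (le_trans (hf _ _))//.
by have := hm _ (leq_maxl m n); lra.
Qed.

End completeness_criterion.

Lemma normR_dist_le (R : realType) (k : scalar_kind)
    (E : normedModType (scalar_field R k)) (x y u v : E) :
  normR (x - y) <= normR (u - v) + (normR (u - x) + normR (v - y)).
Proof.
rewrite (le_trans (normR_dist_triangle u x y))// normR_distC addrCA lerD2l.
exact: normR_dist_triangle.
Qed.

(** * Lipschitz functions *)

Section lip_space.
Context (R : realType) (k : scalar_kind) (X : metricType R).

Lemma mdist_bounded_distance : bounded_space X -> bounded_distance (@mdist R X).
Proof.
move=> bX; split=> //; first exact: mdist_ge0.
  by move=> x y; split=> [/mdist_positivity//|->]; rewrite mdistxx.
move=> z x y; have := metric_triangle z x y; have := metric_triangle z y x.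
by rewrite (metric_sym y x) ler_norml; lra.
Qed.

Lemma lip_normE (E : normedModType (scalar_field R k)) (f : lip X E) :
  normR f = lip_norm f.
Proof. exact: scalar_of_realK. Qed.

Lemma lip_norm_le (E : normedModType (scalar_field R k)) (f : lip X E) M :
  lip_norm f <= M -> lip_bound f M.
Proof.
rewrite ge_max => /andP[_ fM]; have [L0 fL] := lip_constP (lipP f).
split=> [|x y]; first exact: le_trans fM.
by rewrite (le_trans (fL x y))// ler_wpM2r ?mdist_ge0.
Qed.

Lemma lip_function_space (E : completeNormedModType (scalar_field R k)) :
  function_space (@mdist R X) (fun f : lip X E => f : X -> E).
Proof.
have lin a (f g : lip X E) x : (a *: f + g) x = a *: f x + g x by [].
have le (f : lip X E) x : normR (f x) <= normR f.
  rewrite lip_normE (le_trans (supnorm_ub (lipP f).1 x))//.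
  by rewrite le_max lexx.
have closed (f : lip X E) M : (forall (l : seq X) d, 0 < d ->
    exists2 g : lip X E, normR g <= M & {in l, forall x, normR (g x - f x) <= d}) ->
    normR f <= M.
  move=> approx; have M0 : 0 <= M.
    by have [g gM _] := approx [::] 1 ltr01; rewrite (le_trans _ gM)// normR_ge0.
  rewrite lip_normE ge_max; apply/andP; split.
    apply: supnorm_le => // x; apply/ler_addgt0Pr => d d0.
    have [g gM gf] := approx [:: x] d d0.
    rewrite -[f x](subrK (g x)) addrC (le_trans (ler_normRD _ _))//.
    by rewrite lerD ?(le_trans (le g x))// normR_distC gf// mem_head.
  apply: lip_const_le; split=> // x y; apply/ler_addgt0Pr => d d0.
  have [g gM gf] := approx [:: x; y] (d / 2) (divr_gt0 d0 (ltr0Sn _ 1)).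
  rewrite (le_trans (normR_dist_le _ _ (g x) (g y)))//.
  rewrite lip_normE in gM; have [_ gL] := lip_norm_le gM.
  rewrite [in leRHS](splitr d) !lerD ?gf ?gL//.
    by rewrite mem_head.
  by rewrite inE mem_head orbT.
split=> //.
- apply: fast_complete_pointwise lin le closed _.
    exact: complete_fast_complete.
  move=> s r f gs sf; have [r0 rS _] := gs.
  (* The differences [s m - s 0] have Lipschitz constants at most [2 * r 0], a bound kept by the
     pointwise limit; adding [s 0] back shows [f] Lipschitz. *)
  have [C C0 f0L] : exists2 C, 0 <= C & forall x y,
      normR ((f x - s 0%N x) - (f y - s 0%N y)) <= C * mdist x y.
    exists (2 * r 0%N) => [|x y]; first by rewrite mulr_ge0// ltW.
    apply/ler_addgt0Pr => d d0.
    have [m hm] := halving_small rS (divr_gt0 d0 (ltr0Sn _ 3)).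
    rewrite (le_trans (normR_dist_le _ _ ((s m - s 0%N) x) ((s m - s 0%N) y)))//.
    have := fast_cauchy_tail gs (leq0n m); rewrite lip_normE => /lip_norm_le[_ h].
    rewrite lerD ?h//.
    have diffE z : (s m - s 0%N) z - (f z - s 0%N z) = s m z - f z.
      have -> : (s m - s 0%N) z = s m z - s 0%N z by [].
      by rewrite opprB addrA subrK.
    rewrite !diffE ![normR (s m _ - _)]normR_distC.
    by have := sf m x; have := sf m y; have := hm m (leqnn m); lra.
  have [[M s0M] [L s0L]] := lipP (s 0%N).
  have fP : lip_pred f.
    apply/asboolP; split.
      exists (2 * r 0%N + M) => x; rewrite -(subrK (s 0%N x) (f x)).
      by rewrite (le_trans (ler_normRD _ _))// lerD.
    exists (C + L); have -> : f = (fun x => f x - s 0%N x) \+ s 0%N.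
      by apply/funext => x /=; rewrite subrK.
    exact: lip_boundD.
  by exists (Lip fP).
- exists 1 => // h L L0 hL hD.
  have hP : lip_pred h by apply/asboolP; split; [exists L|exists L].
  exists (Lip hP) => //; rewrite lip_normE mul1r ge_max supnorm_le//=.
  exact: lip_const_le.
- move=> f x e e0; have [_ [L [L0 fL]]] := lipP f.
  have L1 : 0 < L + 1 by rewrite ltr_pwDr.
  exists (e / (L + 1)) => [|y]; first exact: divr_gt0.
  rewrite ltr_pdivlMr// => /ltW; apply: le_trans; rewrite (le_trans (fL x y))//.
  by rewrite mulrC ler_wpM2l ?mdist_ge0// lerDl.
Qed.

Lemma perfect_metric : isolated [set: X] = set0 ->
  forall (x : X) (d : R), 0 < d -> exists2 z, z != x & mdist x z < d.
Proof.
move=> iso x d d0; apply: contrapT => nz.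
suff : isolated [set: X] x by rewrite iso.
split; first exact: in_setT.
exists (ball x d); first exact: nbhsx_ballx.
rewrite setIT ballEmdist; apply/seteqP; split=> [z /= xz|_ -> /=].
  by apply: contrapT => /eqP zx; apply: nz; exists z.
by rewrite mdistxx.
Qed.

End lip_space.

(** * Absolutely continuous functions *)

Section ac_space.
Context (R : realType) (k : scalar_kind) (X : compact_set R).
Local Notation K := (scalar_field R k).

Definition ac_dist (x y : X) : R := `|val x - val y|.

Lemma ac_dist_bounded_distance : bounded_distance ac_dist.
Proof.
split=> [x y|x y|z x y|]; first exact: normr_ge0.
- split=> [/normr0_eq0/eqP|->]; last by rewrite /ac_dist subrr normr0.
  by rewrite subr_eq0 => /eqP/val_inj.
- have := ler_dist_dist (val z - val x) (val z - val y); rewrite /ac_dist.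
  by rewrite (_ : val z - val x - _ = val y - val x) 1?[X in _ <= X]distrC//; ring.
have : bounded_set (X : set R^o) by apply: compact_bounded; case: X.
move=> [M [Mr hM]]; exists (2 * (`|M| + 1)) => x y.
have xM (z : X) : `|val z| <= `|M| + 1.
  apply: hM; last exact/set_mem/(valP z).
  by rewrite (le_lt_trans (ler_norm M))// ltrDl.
by rewrite (le_trans (ler_normB _ _))// mulr_natl mulr2n lerD.
Qed.

Section disjoint_variation.
Context (E : normedModType K) (f : X -> E).

(** Recording the endpoint [p] allows a chain to be prolonged to the right. *)
Definition chain_sum_to (p : X) (s : R) := exists n x,
  [/\ increasing_chain n x, x n = p & s <= \sum_(i < n) normR (f (x i.+1) - f (x i))].

Lemma chain_sum_to0 p : chain_sum_to p 0.
Proof. by exists 0%N, (fun=> p); split=> //; rewrite big_ord0. Qed.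

Lemma chain_sum_to_step p q s : chain_sum_to p s -> val p <= val q ->
  chain_sum_to q (s + normR (f q - f p)).
Proof.
move=> ps; rewrite le_eqVlt => /orP[/eqP/val_inj <-|pq].
  by rewrite subrr normR0 addr0.
have [n [x [ix xn sx]]] := ps.
exists n.+1, (fun i => if (i <= n)%N then x i else q); split.
- move=> i; rewrite ltnS leq_eqVlt => /orP[/eqP ->|i_n]/=; first by rewrite eqxx ltnn xn.
  by rewrite i_n orbT; apply: ix.
- by rewrite ltnn.
rewrite big_ord_recr/= leqnn ltnn xn lerD2r (le_trans sx)//.
apply: ler_sum => i _; have i_n := ltn_ord i.
by rewrite (ltnW i_n) i_n.
Qed.

(** Remove the interval with the largest left endpoint. By disjointness every other one ends before
    it starts, so the inductive chain continues through [a i] to [b i]; crossing the gap only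
    increases the sum. *)
Lemma disjoint_chain_sum n (a b : 'I_n -> X) :
  (forall i, val (a i) < val (b i)) ->
  trivIset setT (fun i => `]val (a i), val (b i)[%classic) ->
  forall A : {set 'I_n}, A != finset.set0 -> exists i,
    [/\ i \in A, {in A, forall j, val (a j) <= val (a i)} &
        chain_sum_to (b i) (\sum_(j in A) normR (f (b j) - f (a j)))].
Proof.
move=> ab disj A; move: {2}#|A|.+1 (ltnSn #|A|) => N; elim: N A => // N IH A AN.
move=> /finset.set0Pn[i0 Ai0].
pose i := [arg max_(i > i0 in A) val (a i)]%O.
have [iA imax] : i \in A /\ {in A, forall j, val (a j) <= val (a i)}.
  by rewrite /i; case: Order.TotalTheory.arg_maxP.
exists i; split=> //; rewrite (big_setD1 i iA)/= addrC.
have [A'0|A'0] := eqVneq (A :\ i)%SET finset.set0.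
  by rewrite A'0 big_set0; apply: chain_sum_to_step (ltW (ab i)); exact: chain_sum_to0.
have [|i' [i'A _ i's]] := IH _ _ A'0.
  by have := cardsD1 i A; rewrite iA add1n => e; rewrite e ltnS in AN.
have [i'i i'A'] : i' != i /\ i' \in A by move: i'A; rewrite !inE => /andP[].
have bi' : val (b i') <= val (a i).
  rewrite leNgt; apply/negP => abi.
  have aa := imax _ i'A'; have abi' := ab i.
  have abii := ab i'.
  (* If the intervals overlapped, this midpoint would lie in both. *)
  pose z := (val (a i) + Num.min (val (b i')) (val (b i))) / 2.
  suff : set0 z by [].
  have <- := (trivIsetP.1 disj) i' i I I i'i.
  have m1 : Num.min (val (b i')) (val (b i)) <= val (b i') by rewrite ge_min lexx.
  have m2 : Num.min (val (b i')) (val (b i)) <= val (b i) by rewrite ge_min lexx orbT.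
  have m3 : val (a i) < Num.min (val (b i')) (val (b i)) by rewrite lt_min abi.
  have zin (p q : R) : p < z -> z < q -> `]p, q[%classic z.
    by move=> pz zq; rewrite /= in_itv/= pz zq.
  by split; apply: zin; rewrite /z; lra.
apply: chain_sum_to_step (ltW (ab i)).
have [m [x [ix xm sx]]] := chain_sum_to_step i's bi'.
by exists m, x; split=> //; rewrite (le_trans _ sx)// lerDl normR_ge0.
Qed.

Lemma disjoint_sum_le B : 0 <= B ->
  (forall n x, increasing_chain n x ->
    \sum_(i < n) normR (f (x i.+1) - f (x i)) <= B) ->
  forall n (a b : 'I_n -> X), (forall i, val (a i) < val (b i)) ->
  trivIset setT (fun i => `]val (a i), val (b i)[%classic) ->
  \sum_(i < n) normR (f (b i) - f (a i)) <= B.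
Proof.
move=> B0 fB n a b ab disj.
have [n0|n0] := eqVneq (finset.setTfor 'I_n) finset.set0.
  by rewrite big1// => i _; have := finset.in_setT i; rewrite n0 finset.in_set0.
have [i [_ _ [m [x [ix _ sx]]]]] := disjoint_chain_sum ab disj n0.
rewrite (le_trans _ (fB m x ix))// (le_trans _ sx)//.
by rewrite le_eqVlt; apply/orP; left; apply/eqP/eq_bigl => j; rewrite finset.in_setT.
Qed.

End disjoint_variation.

Lemma ac_normE (E : normedModType K) (f : ac X E) : normR f = ac_norm f.
Proof. exact: scalar_of_realK. Qed.

Lemma ac_function_space (E : completeNormedModType K) :
  function_space ac_dist (fun f : ac X E => f : X -> E).
Proof.
have lin a (f g : ac X E) x : (a *: f + g) x = a *: f x + g x by [].
have le (f : ac X E) x : normR (f x) <= normR f.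
  rewrite ac_normE (le_trans (supnorm_ub (is_ac_bounded (acP f)) x))//.
  by rewrite lerDl total_var_ge0.
have var_le (f : ac X E) n x : increasing_chain n x ->
    \sum_(i < n) normR (f (x i.+1) - f (x i)) <= normR f.
  move=> ix; rewrite ac_normE (le_trans (total_var_ub (acP f) ix))//.
  by rewrite lerDr supnorm_ge0.
have closed (f : ac X E) M : (forall (l : seq X) d, 0 < d ->
    exists2 g : ac X E, normR g <= M & {in l, forall x, normR (g x - f x) <= d}) ->
    normR f <= M.
  move=> approx.
  have M0 : 0 <= M.
    by have [g gM _] := approx [::] 1 ltr01; rewrite (le_trans _ gM)// normR_ge0.
  (* The norm is a sum of two suprema, so a value and a chain sum are bounded together, for
     independent [z] and [x]. *)
  have key z n x : increasing_chain n x ->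
      normR (f z) + \sum_(i < n) normR (f (x i.+1) - f (x i)) <= M.
    move=> ix; apply/ler_addgt0Pr => d d0.
    (* One approximation error for [z] and two for each term of the chain. *)
    pose c : R := 1 + 2 * n%:R.
    have c0 : 0 < c by rewrite /c ltr_pwDl.
    have [g gM gf] := approx (z :: [seq x i | i <- iota 0 n.+1]) (d / c) (divr_gt0 d0 c0).
    have gx i : (i <= n)%N -> normR (g (x i) - f (x i)) <= d / c.
      by move=> i_n; apply: gf; rewrite inE map_f ?orbT// mem_iota.
    have gz : normR (g z - f z) <= d / c by apply: gf; rewrite mem_head.
    have -> : M + d = M + (d / c + \sum_(i < n) (d / c + d / c)).
      by rewrite sumr_const card_ord -mulr_natr /c; field; rewrite gt_eqF.
    have gN : normR (g z) + \sum_(i < n) normR (g (x i.+1) - g (x i)) <= M.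
      rewrite (le_trans _ gM)// ac_normE lerD ?total_var_ub//; last exact: acP.
      by rewrite supnorm_ub//; exact/is_ac_bounded/acP.
    apply: le_trans (lerD gN (lexx _)); rewrite addrACA -big_split/= lerD//.
      rewrite -[f z](subrK (g z)) addrC (le_trans (ler_normRD _ _))//.
      by rewrite lerD// normR_distC.
    apply: ler_sum => i _; rewrite (le_trans (normR_dist_le _ _ (g (x i.+1)) (g (x i))))//.
    by rewrite lerD2l lerD// gx// ltnW.
  have fM x : normR (f x) <= M.
    by have := key x 0%N (fun=> x); rewrite big_ord0 addr0; apply.
  rewrite ac_normE /ac_norm -lerBrDl; apply: total_var_le => [|n x ix].
    by rewrite subr_ge0 supnorm_le.
  rewrite lerBrDl -lerBrDr supnorm_le// => [|z]; last by rewrite lerBrDr key.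
  by rewrite subr_ge0 (le_trans _ (key (x 0%N) n x ix))// lerDr normR_ge0.
split=> //.
- apply: fast_complete_pointwise lin le closed _.
    exact: complete_fast_complete.
  move=> s r f gs sf; have [r0 rS _] := gs.
  have fP : ac_pred f; last by exists (Ac fP).
  apply/asboolP => e e0.
  have [n hn] := halving_small rS (divr_gt0 e0 (ltr0Sn _ 3)).
  have [d d0 hd] := acP (s n) (divr_gt0 e0 (ltr0Sn _ 1)).
  exists d => // m a b ab disj /(hd _ _ _ ab disj) small.
  (* The variation of [f - s n] is at most [2 * r n < e / 2]; absolute continuity of [s n] supplies
     the other half. *)
  have tail : \sum_(i < m) normR ((f (b i) - s n (b i)) - (f (a i) - s n (a i))) <= 2 * r n.
    apply: (disjoint_sum_le (f := fun x => f x - s n x)) ab disj => [|p x ix].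
      by rewrite mulr_ge0// ltW.
    apply/ler_addgt0Pr => t t0.
    (* Each of the [p] terms errs by at most [4 * r q']; [p + 1] keeps the divisor positive. *)
    have c0 : 0 < 4 * (p%:R + 1) :> R by rewrite mulr_gt0// ltr_pwDr.
    have [q hq] := halving_small rS (divr_gt0 t0 c0).
    pose q' := maxn q n.
    have -> : 2 * r n + t = 2 * r n + (p%:R + 1) * (t / (p%:R + 1)).
      by rewrite mulrCA divff ?mulr1// gt_eqF// ltr_pwDr.
    have rq := hq q' (leq_maxl _ _).
    have sqn : normR (s q' - s n) <= 2 * r n.
      by apply: (fast_cauchy_tail gs); rewrite leq_maxr.
    have p1 : 0 < p%:R + 1 :> R by rewrite ltr_pwDr.
    have rt : 2 * r q' + 2 * r q' <= t / (p%:R + 1).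
      by move: rq; rewrite ltr_pdivlMr// ler_pdivlMr//; nra.
    rewrite (@le_trans _ _ (\sum_(i < p) (normR ((s q' - s n) (x i.+1) - (s q' - s n) (x i))
      + t / (p%:R + 1))))//.
      apply: ler_sum => i _.
      rewrite (le_trans (normR_dist_le _ _ ((s q' - s n) (x i.+1)) ((s q' - s n) (x i))))//.
      rewrite lerD2l (le_trans _ rt)//.
      have diffE z : (s q' - s n) z - (f z - s n z) = s q' z - f z.
        have -> : (s q' - s n) z = s q' z - s n z by [].
        by rewrite opprB addrA subrK.
      by rewrite !diffE ![normR (s q' _ - _)]normR_distC lerD.
    rewrite big_split/= sumr_const card_ord lerD//.
      exact: le_trans (var_le (s q' - s n) _ _ ix) sqn.
    by rewrite -[leLHS]mulr_natl ler_wpM2r ?divr_ge0 ?(ltW t0) ?(ltW p1)// lerDl.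
  have := hn n (leqnn n) => rn.
  apply: (@le_lt_trans _ _ (\sum_(i < m) normR (s n (b i) - s n (a i)) +
    \sum_(i < m) normR ((f (b i) - s n (b i)) - (f (a i) - s n (a i))))).
    rewrite -big_split/=; apply: ler_sum => i _.
    rewrite (le_trans _ (ler_normRD _ _))//.
    by rewrite opprB addrACA addKr (addrC (s n (b i))) subrK.
  by lra.
- have [M hM] := dist_bounded ac_dist_bounded_distance.
  (* The supremum contributes [L], and the variation at most [L] times the diameter. *)
  exists (1 + `|M|) => [|h L L0 hL hD]; first by rewrite addr_ge0.
  have hP : ac_pred h.
    apply/asboolP => e e0; have L1 : 0 < L + 1 by rewrite ltr_pwDr.
    exists (e / (L + 1)) => [|n a b ab _]; first exact: divr_gt0.
    rewrite ltr_pdivlMr// mulrC; apply: le_lt_trans.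
    rewrite mulr_sumr; apply: ler_sum => i _; rewrite (le_trans (hD _ _))//.
    rewrite /ac_dist gtr0_norm ?subr_gt0// ler_wpM2r ?lerDl//.
    by rewrite subr_ge0 ltW.
  exists (Ac hP) => //; rewrite ac_normE /ac_norm mulrDl mul1r lerD//=.
    exact: supnorm_le.
  apply: total_var_le => [|n x ix]; first by rewrite mulr_ge0.
  apply: (@le_trans _ _ (\sum_(i < n) L * (val (x i.+1) - val (x i)))).
    apply: ler_sum => i _; rewrite (le_trans (hD _ _))// /ac_dist.
    by rewrite gtr0_norm// subr_gt0 ix.
  rewrite -mulr_sumr mulrC ler_wpM2r//.
  rewrite -(big_mkord xpredT (fun i => val (x i.+1) - val (x i))).
  rewrite (@telescope_sumr _ _ _ (fun i => val (x i)))// (le_trans (ler_norm _))//.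
  by rewrite (le_trans (hM _ _))// ler_norm.
- move=> f x e e0; have [d d0 hd] := acP f e0; exists d => // y.
  (* Absolute continuity for a family of one interval. *)
  have close (u v : X) : val u < val v -> val v - val u < d -> normR (f v - f u) <= e.
    move=> uv uvd; have := hd 1%N (fun=> u) (fun=> v).
    rewrite !big_ord1 => /(_ (fun=> uv))h; apply/ltW/h => //.
    by apply/trivIsetP => i j _ _; rewrite !ord1 eqxx.
  rewrite /ac_dist; have [xy|yx|/val_inj ->] := ltgtP (val x) (val y).
  - by rewrite normR_distC distrC gtr0_norm ?subr_gt0//; exact: close.
  - by rewrite gtr0_norm ?subr_gt0//; exact: close.
  - by move=> _; rewrite subrr normR0 ltW.
Qed.

Lemma perfect_compact_set : isolated X = set0 ->
  forall (x : X) (d : R), 0 < d -> exists2 z, z != x & ac_dist x z < d.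
Proof.
move=> iso x d d0; apply: contrapT => nz.
suff : isolated X (val x) by rewrite iso.
have xX := valP x; split=> //.
exists (ball (val x) d); first exact: nbhsx_ballx.
apply/seteqP; split=> [z [/= xz Xz]|_ -> /=]; last first.
  by split; [exact: ballxx|exact/set_mem].
apply: contrapT => /eqP zx; apply: nz.
by exists (SigSub (mem_set Xz)) => //; rewrite -(inj_eq val_inj).
Qed.

End ac_space.

Theorem theorem5p1 (R : realType) (k : scalar_kind)
    (E F : completeNormedModType (scalar_field R k)) :
  (forall X Y : metricType R,
     bounded_space X -> complete_space X ->
     bounded_space Y -> complete_space Y ->
     forall T : {linear lip X E -> lip Y F},
     bijective T -> preserves_common_zeros T ->
     same_finite_dim E F \/ isolated [set: Y] = set0 ->
     continuous T)
  /\
  (forall X Y : compact_set R,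
     forall T : {linear ac X E -> ac Y F},
     bijective T -> preserves_common_zeros T ->
     same_finite_dim E F \/ isolated Y = set0 ->
     continuous T).
Proof.
split=> [X Y bX _ bY _ T bT TP|X Y T bT TP] dim_or_perfect.
- apply: (common_zeros_continuous (mdist_bounded_distance bX) (lip_function_space X E)
    (mdist_bounded_distance bY) (lip_function_space Y F) bT) => //.
  case: dim_or_perfect; first by left.
  by move=> iso; right; exact: perfect_metric.
- apply: (common_zeros_continuous (ac_dist_bounded_distance X) (ac_function_space X E)
    (ac_dist_bounded_distance Y) (ac_function_space Y F) bT) => //.
  case: dim_or_perfect; first by left.
  by move=> iso; right; exact: perfect_compact_set.
Qed.
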